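(* Let $\underline{\lambda}=(\lambda_1^{\rho_1}>\lambda_2^{\rho_2}>\cdots>\lambda_k^{\rho_k})$ be a partition such that $\lambda_i=k-i+1$ for all $1\leq i\leq k$. Let $p\neq 3$ be an odd prime, let $\mathcal{A}_{\underline{\lambda}}=\bigoplus_{i=1}^k(\mathbb{Z}/p^{\lambda_i}\mathbb{Z})^{\rho_i}$ and let $\mathcal{G}_{\underline{\lambda}}=\operatorname{Aut}(\mathcal{A}_{\underline{\lambda}})$. Then $H^2(\mathcal{G}_{\underline{\lambda}},\mathbb{Z}/p\mathbb{Z})=0$ for the trivial action of $\mathcal{G}_{\underline{\lambda}}$ on $\mathbb{Z}/p\mathbb{Z}$. As a consequence, $H^2(\mathcal{G}_{\underline{\lambda}},\mathcal{A}_{\underline{\lambda}})=0$ for the trivial action of $\mathcal{G}_{\underline{\lambda}}$ on $\mathcal{A}_{\underline{\lambda}}$.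
   Context: A partition $\underline{\lambda}=(\lambda_1^{\rho_1}>\cdots>\lambda_k^{\rho_k})$ consists of positive integers $\lambda_1>\lambda_2>\cdots>\lambda_k$ (the distinct parts) with positive integer multiplicities $\rho_1,\dots,\rho_k$, $k\geq 1$. $H^i$ denotes ordinary group cohomology. *)

(* Defs.v *)
From HB Require Import structures.
From mathcomp Require Import all_boot all_order all_algebra all_fingroup.

Set Implicit Arguments.
Unset Strict Implicit.
Unset Printing Implicit Defensive.

Import GRing.Theory.
Local Open Scope ring_scope.

(* Partitions (l_1^r_1 > ... > l_k^r_k).  The index i : 'I_k is zero-based:   *)
(* [part la i] and [multiplicity la i] are l_(i+1) and r_(i+1).               *)
Record mpartition := MPartition {
  nparts : nat;
  part : 'I_nparts -> nat;
  multiplicity : 'I_nparts -> nat;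
  nparts_gt0 : (0 < nparts)%N;
  part_gt0 : forall i, (0 < part i)%N;
  multiplicity_gt0 : forall i, (0 < multiplicity i)%N;
  part_decr : forall i j : 'I_nparts, (i < j)%N -> (part j < part i)%N
}.
Arguments part : clear implicits.
Arguments multiplicity : clear implicits.

(* Direct sum of a finite family of finite abelian groups, with pointwise     *)
(* addition.  The alias keeps this additive structure apart from the          *)
(* multiplicative group structure already canonical on {dffun _}; here the    *)
(* finGroupType structure is the one underlying the addition.                 *)
Definition dsum (I : finType) (T : I -> finZmodType) : Type :=
  {dffun forall i, T i}.

Section DirectSum.
Variables (I : finType) (T : I -> finZmodType).

HB.instance Definition _ := Finite.copy (dsum T) {dffun forall i, T i}.

Definition dsum_zero : dsum T := [ffun i => 0 : T i].
Definition dsum_opp (x : dsum T) : dsum T := [ffun i => - (x i : T i)].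
Definition dsum_add (x y : dsum T) : dsum T := [ffun i => (x i : T i) + y i].

Fact dsum_addA : associative dsum_add.
Proof. by move=> x y z; apply/ffunP=> i; rewrite !ffunE addrA. Qed.
Fact dsum_addC : commutative dsum_add.
Proof. by move=> x y; apply/ffunP=> i; rewrite !ffunE addrC. Qed.
Fact dsum_add0 : left_id dsum_zero dsum_add.
Proof. by move=> x; apply/ffunP=> i; rewrite !ffunE add0r. Qed.
Fact dsum_addN : left_inverse dsum_zero dsum_opp dsum_add.
Proof. by move=> x; apply/ffunP=> i; rewrite !ffunE addNr. Qed.

HB.instance Definition _ :=
  GRing.isZmodule.Build (dsum T) dsum_addA dsum_addC dsum_add0 dsum_addN.
HB.instance Definition _ := [finGroupMixin of dsum T for +%R].

End DirectSum.

(* The summands are indexed by the pairs (i, j) with j < multiplicity la i.   *)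
(* For p prime the moduli are at least 2, so that 'Z_m is indeed Z/m.         *)
Definition abgrp (p : nat) (la : mpartition) : finZmodType :=
  dsum (fun x : {i : 'I_(nparts la) & 'I_(multiplicity la i)} =>
          'Z_(p ^ part la (tag x)) : finZmodType).

Definition autgrp (p : nat) (la : mpartition) : finGroupType :=
  [subg Aut [set: abgrp p la]].

Record gmodule (gT : finGroupType) := GModule {
  gmod_sort :> finZmodType;
  gmod_act : gT -> gmod_sort -> gmod_sort;
  gmod_actD : forall g, {morph gmod_act g : x y / x + y};
  gmod_act1 : forall x, gmod_act 1%g x = x;
  gmod_actM : forall g h x, gmod_act (g * h)%g x = gmod_act g (gmod_act h x)
}.

Definition trivial_gmodule (gT : finGroupType) (M : finZmodType) : gmodule gT :=
  @GModule gT M (fun _ x => x)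
    (fun _ _ _ => erefl) (fun _ => erefl) (fun _ _ _ => erefl).

(* Group cohomology, by inhomogeneous cochains.                               *)
Definition cochain (gT : finGroupType) (M : gmodule gT) (n : nat) : Type :=
  {ffun n.-tuple gT -> M}.

Section Cohomology.
Variables (gT : finGroupType) (M : gmodule gT).

HB.instance Definition _ n :=
  Finite.copy (cochain M n) {ffun n.-tuple gT -> M}.
HB.instance Definition _ n :=
  GRing.Zmodule.copy (cochain M n) {ffun n.-tuple gT -> M}.
HB.instance Definition _ n := [finGroupMixin of cochain M n for +%R].

Section Faces.
Variables (n : nat) (t : n.+1.-tuple gT).

Definition face_first : n.-tuple gT := [tuple tnth t (lift ord0 j) | j < n].
Definition face_last : n.-tuple gT := [tuple tnth t (lift ord_max j) | j < n].

(* (g_0, ..., g_n) |-> (g_0, ..., g_i * g_(i+1), ..., g_n) *)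
Definition face_mul (i : 'I_n) : n.-tuple gT :=
  [tuple if (j < i)%N then tnth t (lift ord_max j)
         else if j == i then (tnth t (lift ord_max j) * tnth t (lift ord0 j))%g
         else tnth t (lift ord0 j) | j < n].

End Faces.

Definition differential n (f : cochain M n) : cochain M n.+1 :=
  [ffun t : n.+1.-tuple gT =>
     gmod_act (thead t) (f (face_first t))
     + \sum_(i < n) f (face_mul t i) *~ (-1) ^+ i.+1
     + f (face_last t) *~ (-1) ^+ n.+1].

Fact differentialD n : {morph @differential n : f g / f + g}.
Proof.
move=> f g; apply/ffunP=> t; rewrite !ffunE gmod_actD mulrzDl.
under eq_bigr do rewrite ffunE mulrzDl.
by rewrite big_split [RHS]addrACA; congr (_ + _); apply: addrACA.
Qed.

Canonical differential_morphism n :=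
  @Morphism _ _ [set: cochain M n] (@differential n)
    (in2W (@differentialD n)).

Definition cocycles n : {set cochain M n} := ('ker (@differential n))%g.

Definition coboundaries n : {set cochain M n} :=
  if n is m.+1 then (@differential m @* [set: cochain M m])%g else 1%g.

Canonical cocycles_group n := [group of cocycles n].
Fact coboundaries_group_set n : group_set (coboundaries n).
Proof. by case: n => [|n]; apply: groupP. Qed.
Canonical coboundaries_group n := Group (coboundaries_group_set n).

Definition cohomology n : {set coset_of (coboundaries n)} :=
  (cocycles n / coboundaries n)%g.

Canonical cohomology_group n := [group of cohomology n].

End Cohomology.

(* Main.v *)
From HB Require Import structures.
Require Import Defs.
From mathcomp Require Import all_boot all_order all_algebra all_fingroup.
From mathcomp Require Import all_solvable mxabelem finfield ring.

(* Call a finite group G "pgood" when it is generated by its p'-elements and  *)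
(* every central extension of G by a p-group splits; for central kernels this *)
(* amounts to H^1(G, Z/p) = H^2(G, Z/p) = 0.  Pgood groups are closed under   *)
(* extensions, and pgood passes from a subgroup of index prime to p to the    *)
(* whole group (Gaschütz).                                                    *)
(*   Restriction to pA maps Aut A onto Aut (pA), and pA is again the group of *)
(* a staircase partition, so by induction one has to show that the kernel,    *)
(* the centralizer of pA in Aut A, is pgood.  Since 1 is a part, A[p] is not  *)
(* contained in pA.  A Sylow p-subgroup of the kernel fixes a coset pA + y of *)
(* some y of order p; restricting to the stabilizer of pA + <y> and repeating *)
(* leads to the centralizers of subgroups C with pA <= C and A[p] <= C + <y>. *)
(* Such a centralizer contains, with index prime to p, a group generated by   *)
(* V = Hom(<y>, C[p]), W = Hom(A / (C + <y>), <y>) and an automorphism t that *)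
(* doubles y and fixes a complement.  There [V, W] is the tensor product of V *)
(* and W, central in <V, W>, and t acts on V and W by 2 and 1/2 (in           *)
(* some order).  In a central extension, bilinearity of commutators and       *)
(* invariance under t kill the obstructions, because 2, 4 and 1/4 differ from *)
(* 1 modulo p; this is where p <> 2, 3 is used.                               *)

(** Both vanishing statements reduce to one property of Aut A. A 2-cocycle with values in a trivial
    module M makes M x G a central extension of G with kernel M, and a complement of M is a cochain
    whose coboundary is the cocycle ([cocycle_split]). Since Z/p and A are both p-groups, it
    suffices that Aut A is pgood ([Aut_pgood]). The induction along A, pA, p^2 A, ... rests on
    [morphim_pgood] (closure under extensions) and [extend_Aut_powers] (automorphisms of pA extend
    to A). The kernels are handled by [centralizer_powers_pgood], which adjoins elements of order p
    one at a time and passes to subgroups of index prime to p with [p'_index_pgood]. What remains is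
    [centralizer_pgood], where [p_elt_heis] shows that the group generated by V, W and t contains
    all p-elements. That this group is pgood is [heisenberg_pgood], whose core is [central_section]:
    the squaring action singles out multiplicative lifts of V and of W. *)

Set Implicit Arguments.
Unset Strict Implicit.
Unset Printing Implicit Defensive.
Import GRing.Theory.

(** * Split central extensions *)

Section PGood.
Local Open Scope group_scope.

Definition central_ext_split (p : nat) (rT : finGroupType) (G : {set rT}) :=
  forall (gT : finGroupType) (E : {group gT}) (f : {morphism E >-> rT}),
    f @* E = G -> 'ker f \subset 'Z(E) -> p.-group ('ker f) ->
  [splits E, over 'ker f].

Definition p'_elts (p : nat) (gT : finGroupType) (G : {set gT}) : {set gT} :=
  [set x in G | p^'.-elt x].

(** Generation by p'-elements forces a complement of a central p-kernel to be unique: it is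
    generated by the p'-elements of the extension. This is what lets complements survive conjugation
    by a larger group. *)
Definition pgood (p : nat) (gT : finGroupType) (G : {set gT}) :=
  G \subset <<p'_elts p G>> /\ central_ext_split p G.

Variable p : nat.
Implicit Types gT aT rT : finGroupType.

Lemma p'_elts_sub gT (G : {set gT}) : p'_elts p G \subset G.
Proof. by apply/subsetP=> x /setIdP[]. Qed.

Lemma p'_elt_lift aT rT (D : {group aT}) (f : {morphism D >-> rT}) (y : rT) :
  y \in f @* D -> p^'.-elt y -> exists x, [/\ x \in D, p^'.-elt x & f x = y].
Proof.
case/morphimP=> x _ Dx -> p'fx; exists x.`_p^'; split.
- exact: groupX.
- exact: p_elt_constt.
- by rewrite morph_constt // constt_p_elt.
Qed.

Lemma gen_p'_elts_char gT (G : {group gT}) : <<p'_elts p G>> \char G.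
Proof.
apply/charP; split=> [|f injf fG]; first by rewrite gen_subG p'_elts_sub.
rewrite morphim_gen ?p'_elts_sub //.
have sub : f @* p'_elts p G \subset p'_elts p G.
  apply/subsetP=> _ /morphimP[x Gx /setIdP[_ p'x] ->].
  have := mem_morphim f Gx Gx; rewrite fG => Gfx.
  by rewrite inE Gfx morph_p_elt.
apply/eqP; rewrite eqEcard genS //=.
by rewrite -morphim_gen ?p'_elts_sub // card_injm // gen_subG p'_elts_sub.
Qed.

Lemma trivg_pgood gT : pgood p [1 gT].
Proof.
split=> [|hT E f fE _ _]; first by rewrite sub1G.
have -> : 'ker f = E.
  apply/eqP; rewrite eqEsubset subsetIl /=; apply/subsetP=> x Ex.
  by apply/kerP=> //; apply/set1gP; rewrite -fE mem_morphim.
apply/splitsP; exists 1%G; rewrite inE /=.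
by rewrite setIC (setIidPl (sub1G _)) mulg1 !eqxx.
Qed.

(* The p'-elements of the preimage of ker g generate a complement of ker f in *)
(* it that is normal in E, and then it suffices to split the quotient.        *)
Lemma morphim_pgood aT rT (G : {group aT}) (g : {morphism G >-> rT}) :
  pgood p ('ker g) -> pgood p (g @* G) -> pgood p G.
Proof.
move=> [genN splN] [genG' splG']; split.
  have sNO : 'ker g \subset <<p'_elts p G>>.
    apply: subset_trans genN _; apply: genS; apply/subsetP=> x.
    by case/setIdP=> Kx p'x; rewrite inE p'x (subsetP (subsetIl _ _) _ Kx).
  rewrite -(mulSGid sNO) -morphimK ?gen_subG ?p'_elts_sub //.
  rewrite -sub_morphim_pre //.
  apply: subset_trans genG' _; rewrite morphim_gen ?p'_elts_sub //; apply: genS.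
  apply/subsetP=> y /setIdP[Gy p'y].
  have [x [Gx p'x <-]] := p'_elt_lift Gy p'y.
  by rewrite mem_morphim // inE Gx.
move=> gT E f fE cK pK.
pose M := (f @*^-1 ('ker g))%G.
have sME : M \subset E by apply: subsetIl.
have sKM : 'ker f \subset M by rewrite kerE morphpreS // sub1G.
have fM : f @* M = 'ker g by rewrite morphpreK // fE subsetIl.
pose f1 := restrm sME f.
have kf1 : 'ker f1 = 'ker f by rewrite ker_restrm (setIidPr sKM).
have nsKE : 'ker f <| E by apply: ker_normal.
have sMf x : x \in M -> f x = 1 -> x \in 'ker f.
  by move=> Mx fx1; apply/kerP => //; apply: (subsetP sME).
have cKM : 'ker f \subset 'Z(M).
  by rewrite subsetI sKM (subset_trans (subset_trans cK (subsetIr _ _))) ?centS.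
have /splitsP[Q0 /complP[tiKQ0 mulKQ0]] : [splits M, over 'ker f].
  have := splN _ M [morphism of f1]; rewrite /= kf1; apply=> //.
  by rewrite morphim_restrm setIid.
pose Q := <<p'_elts p M>>%G.
have sQM : Q \subset M by rewrite gen_subG p'_elts_sub.
have nsME : M <| E.
  have {1}<- : f @*^-1 (f @* E) = E by rewrite morphimGK ?subsetIl.
  rewrite morphpre_normal ?fE ?ker_normal //; exact: subsetIl.
have nsQE : Q <| E by apply: char_normal_trans nsME; apply: gen_p'_elts_char.
have sQQ0 : Q \subset Q0.
  rewrite gen_subG; apply/subsetP=> x /setIdP[Mx p'x].
  have: x \in 'ker f * Q0 by rewrite mulKQ0.
  (* The factor k is central and of p-power order, so x, being its own p'-constituent, is the
     p'-constituent of q and lies in Q0. *)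
  case/mulsgP=> k q Kk Qq def_x; rewrite -(constt_p_elt p'x) def_x.
  have Eq : q \in E by rewrite (subsetP sME) // -mulKQ0 (subsetP (mulG_subr _
    _)).
  have ckq : commute k q.
    by apply: (centP (subsetP (subset_trans cK (subsetIr _ _)) k Kk)).
  have /constt1P k1: p^'^'.-elt k by rewrite /p_elt pnatNK;
    apply: mem_p_elt pK Kk.
  by rewrite consttM // k1 mul1g groupX.
have tiKQ : 'ker f :&: Q = 1 by apply/trivgP; rewrite -tiKQ0 setIS.
have fQ : f @* Q = 'ker g.
  have sfQ : f @* Q \subset 'ker g by rewrite -fM morphimS.
  apply/eqP; rewrite eqEsubset sfQ; apply: subset_trans genN _;
    rewrite morphim_gen; last first.
    by rewrite (subset_trans (p'_elts_sub _)).
  apply: genS; apply/subsetP=> y /setIdP[]; rewrite -fM => My p'y.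
  have [x [Mx p'x <-]] : exists x, [/\ x \in M, p^'.-elt x & f x = y].
    have := @p'_elt_lift _ _ _ [morphism of f1] y.
    by rewrite morphim_restrm setIid; apply.
  by apply: mem_morphim; [apply: (subsetP sME) | rewrite inE Mx].
have mulKQ : 'ker f * Q = M by rewrite -morphimK ?fQ // (subset_trans sQM).
(* [domP] turns the composite, whose domain is a preimage, into a morphism with domain E. *)
have [h [hE kerh _ imh]] : {h : {morphism E >-> rT} | [/\ h = g \o f :> (gT ->
  rT),
    'ker h = 'ker (g \o f), forall R, h @*^-1 R = (g \o f) @*^-1 R
    & forall B, h @* B = (g \o f) @* B]}.
  apply: domP; have: f @*^-1 (f @* E) = E by rewrite morphimGK ?subsetIl.
  by rewrite fE.
have {}kerh : 'ker h = M by rewrite kerh ker_comp.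
have sQh : 'ker (coset Q) \subset 'ker h by rewrite ker_coset kerh.
have nQE : E \subset 'N(Q) by apply: normal_norm.
have kerhQ : 'ker (factm sQh nQE) = 'ker f / Q.
  by rewrite -(quotientMidr Q) mulKQ ker_factm kerh.
(* E / Q is a central extension of the image of g by the image of ker f. The preimage C of a
   complement meets ker f inside Q, hence trivially. *)
have /splitsP[Cq /complP[tiCq mulCq]] : [splits E / Q,
  over 'ker (factm sQh nQE)].
  apply: (splG' _ (E / Q)%G); rewrite /= ?kerhQ.
  - by rewrite morphim_factm imh morphim_comp fE.
  - rewrite subsetI quotientS ?subsetIl //=.
    by rewrite quotient_cents // (subset_trans cK (subsetIr _ _)).
  - exact: quotient_pgroup.
have sCqE : Cq \subset E / Q by rewrite -mulCq mulG_subr.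
have [C defC sQC sCE] := inv_quotientS nsQE sCqE.
apply/splitsP; exists C; apply/complP.
have sKE : 'ker f \subset E by apply: subsetIl.
have tiKC : 'ker f :&: C = 1.
  apply/trivgP; rewrite -tiKQ subsetI subsetIl /=.
  rewrite -quotient_sub1 ?(subset_trans (subsetIr _ _)) ?(subset_trans sCE) //.
  by rewrite -tiCq kerhQ defC quotientI.
split=> //.
apply/eqP; rewrite eqEsubset mul_subG //=.
have -> : 'ker f * C = coset Q @*^-1 ('ker f / Q * (C / Q)).
  rewrite -quotientMl ?(subset_trans sKE) // quotientK; last first.
    by rewrite mul_subG ?(subset_trans sKE) ?(subset_trans sCE).
  by rewrite mulgA -(normC (subset_trans sKE nQE)) -mulgA (mulSGid sQC).
by rewrite -defC -kerhQ mulCq -sub_quotient_pre.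
Qed.

(* Restricted to the preimage of P, the extension splits by hypothesis, and   *)
(* that preimage has index prime to p: this is Gaschütz's theorem.            *)
Lemma p'_index_pgood gT (G P : {group gT}) :
  P \subset G -> p^'.-nat #|G : P| -> pgood p P -> pgood p G.
Proof.
move=> sPG p'GP [genP splP]; split.
  have /andP[sOG nOG] : <<p'_elts p G>> <| G.
    by apply: char_normal; apply: gen_p'_elts_char.
  have sPO : P \subset <<p'_elts p G>>.
    apply: subset_trans genP _; apply: genS; apply/subsetP=> x /setIdP[Px p'x].
    by rewrite inE p'x (subsetP sPG).
  have p'GO : p^'.-group (G / <<p'_elts p G>>).
    by rewrite /pgroup card_quotient // (pnat_dvd (indexgS G sPO)).
  (* The quotient by the subgroup generated by the p'-elements is a p'-group, so the p-part of x
     dies in it; the p'-part of x is one of the generators. *)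
  apply/subsetP=> x Gx; rewrite -(consttC p x); apply: groupM.
    have nOx : x.`_p \in 'N(<<p'_elts p G>>) by rewrite (subsetP nOG) ?groupX.
    apply: coset_idr => //; apply/eqP; rewrite -order_eq1; apply/eqP.
    have p'cx : p^'.-elt (coset <<p'_elts p G>> x.`_p).
      by apply: mem_p_elt p'GO _; rewrite mem_quotient ?groupX.
    have pcx := morph_p_elt (coset_morphism <<p'_elts p G>>) nOx (p_elt_constt p
      x).
    exact: (pnat_1 pcx p'cx).
  by rewrite mem_gen // inE p_elt_constt groupX.
move=> hT E f fE cK pK.
pose M := (f @*^-1 P)%G.
have sME : M \subset E by apply: subsetIl.
have sKM : 'ker f \subset M by rewrite kerE morphpreS // sub1G.
have nsKE : 'ker f <| E by apply: ker_normal.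
have abK : abelian ('ker f).
  by rewrite /abelian (subset_trans (subset_trans cK (subsetIr _ _))) ?centS
    ?subsetIl.
have coi : coprime #|'ker f| #|E : M|.
  apply: pnat_coprime pK _; suff -> : #|E : M| = #|G : P| by [].
  have defE : f @*^-1 G = E.
    by have: f @*^-1 (f @* E) = E by [rewrite morphimGK ?subsetIl]; rewrite fE.
  have <- : #|f @*^-1 G : M| = #|E : M| by rewrite defE.
  by rewrite index_morphpre ?fE.
rewrite (Gaschutz_split nsKE sKM sME abK coi).
have kf1 : 'ker (restrm sME f) = 'ker f by rewrite ker_restrm (setIidPr sKM).
have := splP _ M [morphism of restrm sME f]; rewrite /= kf1; apply=> //.
  by rewrite morphim_restrm setIid morphpreK // fE.
by rewrite subsetI sKM (subset_trans (subset_trans cK (subsetIr _ _))) ?centS.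
Qed.

End PGood.

(** * Lifting a squaring action to a central extension *)

Section CentralLift.
Local Open Scope group_scope.
Variables (p : nat) (gT rT : finGroupType) (E : {group gT}).
Variable f : {morphism E >-> rT}.
Hypotheses (cK : 'ker f \subset 'Z(E)) (pK : p.-group ('ker f)).
Hypothesis p3 : p^'.-nat 3.

Lemma ker_commute k x : k \in 'ker f -> x \in E -> commute k x.
Proof. by move=> Kk Ex; apply: (centP (subsetP (subset_trans cK (subsetIr _ _))
  k Kk)). Qed.

Lemma kerP_eq x y : x \in E -> y \in E -> f x = f y -> exists2 k,
  k \in 'ker f & x = k * y.
Proof.
move=> Ex Ey fxy; exists (x * y^-1); last by rewrite mulgKV.
by apply/kerP; rewrite ?groupM ?groupV // morphM ?morphV ?groupV // fxy mulgV.
Qed.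

(** Lifts of the same element differ by a central factor, which commutators do not see. *)
Lemma comm_ker_eq a a' b b' : a \in E -> a' \in E -> b \in E -> b' \in E ->
  f a = f a' -> f b = f b' -> [~ a, b] = [~ a', b'].
Proof.
move=> Ea Ea' Eb Eb' /(kerP_eq Ea Ea')[k Kk ->] /(kerP_eq Eb Eb')[l Kl ->].
have El : l \in E by apply: (subsetP (subsetIl _ _) _ Kl).
have /commgP/eqP ck1 := ker_commute Kk (groupM El Eb').
have /commgP/eqP ca'l := commute_sym (ker_commute Kl Ea').
by rewrite commMgJ ck1 conj1g mul1g commgMJ ca'l conj1g mulg1.
Qed.

Lemma exp3_eq1 (hT : finGroupType) (x : hT) : p.-elt x -> x ^+ 3 = 1 -> x = 1.
Proof.
move=> px /eqP; rewrite -order_dvdn => o3; apply/eqP; rewrite -order_eq1.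
by apply/eqP; apply: (pnat_1 px); apply: pnat_dvd o3 p3.
Qed.

Variables (V : {group rT}) (tau : gT).
Hypotheses (Etau : tau \in E) (sVE : V \subset f @* E) (cVV : abelian V).
Hypothesis tauV : forall v, v \in V -> v ^ f tau = v ^+ 2.

(* Conjugation by tau fixes the central element [~ a, b] and maps it to its   *)
(* fourth power.                                                              *)
Lemma lift_abelian a b : a \in E -> b \in E -> f a \in V -> f b \in V ->
  commute a b.
Proof.
move=> Ea Eb Va Vb; have Kz : [~ a, b] \in 'ker f.
  by apply/kerP; rewrite ?groupR // morphR //; apply/eqP/commgP/(centsP cVV).
have zz := ker_commute Kz; apply/commgP/eqP/exp3_eq1; first exact: mem_p_elt Kz.
apply: (mulgI [~ a, b]); rewrite -expgS mulg1.
rewrite -[4]/(2 * 2)%N -commXXg; try exact/commute_sym/zz.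
rewrite -[RHS](mulKg tau) -(zz _ Etau) -conjgE conjRg.
by apply: comm_ker_eq; rewrite ?groupX ?groupJ // morphX // morphJ // tauV.
Qed.

(** The canonical lift of v is the commutator of any lift r v with tau. It maps to the product of
    v^-1 and v^2, that is to v, and it does not depend on the choice of r v. As lifts of elements of
    V commute with one another, this independence makes the section multiplicative and equivariant
    under tau. *)
Lemma central_section : exists s : rT -> gT,
  [/\ {in V, forall v, s v \in E}, {in V, forall v, f (s v) = v},
      {in V &, {morph s : x y / x * y}} & {in V, forall v,
        s v ^ tau = s v ^+ 2}].
Proof.
pose r v := repr (f @*^-1 [set v]).
have rP v : v \in V -> r v \in E /\ f (r v) = v.
  move=> Vv; have /mem_repr: v \in f @* E by apply: (subsetP sVE).
  case/morphimP: (subsetP sVE v Vv) => x Ex _ def_v _.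
  have /mem_repr: x \in f @*^-1 [set v] by rewrite !inE Ex def_v /=.
  by rewrite -/(r v) !inE => /andP[-> /eqP].
have sE v a : v \in V -> a \in E -> f a = v -> [~ r v, tau] = [~ a, tau].
  by move=> Vv Ea fa; have [Er fr] := rP v Vv; apply: comm_ker_eq; rewrite ?fr.
have fs a : a \in E -> f a \in V -> f [~ a, tau] = f a.
  by move=> Ea Va; rewrite morphR // commgEl tauV // expgS expg1 mulKg.
exists (fun v => [~ r v, tau]); split=> [v Vv|v Vv|v w Vv Vw|v Vv] /=.
- by have [Er _] := rP v Vv; rewrite groupR.
- by have [Er fr] := rP v Vv; rewrite fs ?fr.
- have [Ev fv] := rP v Vv; have [Ew fw] := rP w Vw.
  rewrite (sE (v * w) (r v * r w)) ?groupM ?morphM ?fv ?fw //.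
  rewrite commMgJ; congr (_ * _); apply/conjg_fixP/commgP.
  by apply: lift_abelian; rewrite ?groupR ?fs ?fv ?fw.
have [Ev fv] := rP v Vv.
rewrite conjRg [tau ^ tau]conjgE mulKg -commXg; last first.
  by apply: lift_abelian; rewrite ?groupR ?fs ?fv.
by apply: comm_ker_eq; rewrite ?groupX ?groupJ // morphX // morphJ // fv tauV.
Qed.

End CentralLift.

(** * Heisenberg groups *)

Section Heisenberg.
Local Open Scope group_scope.

Lemma prodgM_comm (gT : finGroupType) (I : Type) (r : seq I) (a b : I -> gT) :
  (forall i j, commute (a i) (b j)) ->
  (\prod_(i <- r) a i) * (\prod_(i <- r) b i) = \prod_(i <- r) (a i * b i).
Proof.
move=> cab; elim: r => [|i r IHr]; first by rewrite !big_nil mulg1.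
have cbi : commute (\prod_(j <- r) a j) (b i).
  elim: r {IHr} => [|j r IHr]; first by rewrite big_nil;
    apply: commute_sym (commute1 _).
  by rewrite big_cons; apply/commute_sym/commuteM; apply: commute_sym.
by rewrite !big_cons -IHr mulgA -(mulgA (a i)) cbi !mulgA.
Qed.

Variables (p : nat) (rT : finGroupType) (V W : {group rT}) (t : rT).
Variables (I : finType) (w : I -> rT).
Hypothesis p3 : p^'.-nat 3.
Hypotheses (pV : p.-group V) (cVV : abelian V).
Hypothesis cWW : abelian W.
Hypothesis p't : p^'.-elt t.
Hypothesis tV : forall v, v \in V -> v ^ t = v ^+ 2.
Hypothesis tW : forall x, x \in W -> x ^ (t^-1) = x ^+ 2.
Hypothesis cRV : {in V & W, forall v x, forall u, u \in V -> commute [~ v,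
  x] u}.
Hypothesis cRW : {in V & W, forall v x, forall u, u \in W -> commute [~ v,
  x] u}.
Hypotheses (Ww : forall i, w i \in W) (genW : W \subset <<[set w i | i in I]>>).
Hypothesis injR : forall v : I -> rT, (forall i, v i \in V) ->
  \prod_i [~ v i, w i] = 1 -> forall i, v i = 1.

Let H := V <*> W <*> <[t]>.

(** If s squares x by conjugation, then x equals the commutator of x and s, which is the product of
    a conjugate of s^-1 and s, two p'-elements. *)
Lemma heisenberg_gen : H \subset <<p'_elts p H>>.
Proof.
have sVH : V \subset H by rewrite /H -joingA joing_subl.
have sWH : W \subset H by rewrite /H (joingC V) -joingA joing_subl.
have Ht : t \in H by rewrite mem_gen // inE cycle_id orbT.
have p'H (x : rT) : x \in H -> p^'.-elt x -> x \in <<p'_elts p H>>.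
  by move=> Hx p'x; rewrite mem_gen // inE Hx.
have aux (x s : rT) : x \in H -> s \in H -> p^'.-elt s -> x ^ s = x ^+ 2 ->
    x \in <<p'_elts p H>>.
  move=> Hx Hs p's xs; have -> : x = (s^-1) ^ x * s.
    by rewrite -[s^-1 ^ x * s]commgEr commgEl xs expgS mulKg expg1.
  by rewrite groupM // p'H ?groupJ ?groupV // p_eltJ p_eltV.
have sT : <[t]> \subset <<p'_elts p H>> by rewrite cycle_subG p'H.
rewrite -[H]/(_ <*> _) join_subG sT andbT join_subG.
apply/andP; split; apply/subsetP=> x.
  by move=> Vx; apply: (aux _ t); rewrite ?tV // (subsetP sVH).
by move=> Wx; apply: (aux _ t^-1); rewrite ?tW ?groupV ?p_eltV // (subsetP sWH).
Qed.

(** Lift V and W by [central_section] to s and z. The commutators R v x of the lifts are again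
    multiplicative in both arguments and central in the group Q generated by the lifts; [injR],
    saying that [V, W] is freely built from the w i with coefficients in V, makes Q meet ker f
    trivially. As (ker f) Q has index prime to p in E, Gaschütz's theorem takes care of tau. *)
Lemma heisenberg_split : central_ext_split p H.
Proof.
move=> gT E f fE cK pK.
have sVH : V \subset H by rewrite /H -joingA joing_subl.
have sWH : W \subset H by rewrite /H (joingC V) -joingA joing_subl.
have Ht : t \in H by rewrite mem_gen // inE cycle_id orbT.
have [tau [Et p'tau ftau]] : exists x, [/\ x \in E, p^'.-elt x & f x = t].
  by apply: p'_elt_lift; rewrite ?fE.
have sVE : V \subset f @* E by rewrite fE.
have sWE : W \subset f @* E by rewrite fE.
have tauV v : v \in V -> v ^ f tau = v ^+ 2 by rewrite ftau; apply: tV.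
have tauW v : v \in W -> v ^ f (tau^-1) = v ^+ 2.
  by rewrite morphV // ftau; apply: tW.
have [s [Es fs sM sJ]] := central_section cK pK p3 Et sVE cVV tauV.
have EtV : tau^-1 \in E by rewrite groupV.
have [z [Ez fz zM zJ]] := central_section cK pK p3 EtV sWE cWW tauW.
pose R v x := [~ s v, z x].
have nWt : t \in 'N(W).
  rewrite -groupV inE; apply/subsetP=> _ /imsetP[x Wx ->].
  by rewrite tW ?groupX.
have tWV x : x \in W -> x ^ t \in W /\ (x ^ t) ^+ 2 = x.
  by move=> Wx; rewrite -tW memJ_norm // conjgK.
(* Conjugation by t squares v and replaces x by its square root, so the two effects cancel in the
   commutator. *)
have tR v x : v \in V -> x \in W -> [~ v, x] ^ t = [~ v, x].
  move=> Vv Wx; have [Wxt xt2] := tWV x Wx.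
  rewrite conjRg tV // -[in RHS]xt2 commXg ?commgX //; apply: commute_sym.
    exact: cRW.
  exact: cRV.
have fR v x : v \in V -> x \in W -> f (R v x) = [~ v, x].
  by move=> Vv Wx; rewrite morphR ?Es ?Ez // fs // fz.
have ER v x : v \in V -> x \in W -> R v x \in E.
  by move=> Vv Wx; rewrite groupR ?Es ?Ez.
(* The commutator c of R v x and s u is central, hence fixed by tau. But tau fixes R v x modulo ker
   f and squares s u, so c = c^2. The argument for [cRz] is the same with tau^-1. *)
have cRs v x u : v \in V -> x \in W -> u \in V -> commute (R v x) (s u).
  move=> Vv Wx Vu; have Kc : [~ R v x, s u] \in 'ker f.
    apply/kerP; first by rewrite groupR ?Es ?ER.
    by rewrite morphR ?Es ?ER // fR // fs //; apply/eqP/commgP/cRV.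
  have cc := ker_commute cK Kc.
  apply/commgP/eqP; apply: (mulgI [~ R v x, s u]).
  rewrite mulg1 -expg2 -commgX; last exact/commute_sym/cc/Es.
  rewrite -[RHS](mulKg tau) -(cc _ Et) -conjgE conjRg sJ //.
  apply: (comm_ker_eq cK); rewrite ?groupX ?groupJ ?ER ?Es //.
  by rewrite morphJ ?ER ?fR ?ftau ?tR.
have cRz v x u : v \in V -> x \in W -> u \in W -> commute (R v x) (z u).
  move=> Vv Wx Wu; have Kc : [~ R v x, z u] \in 'ker f.
    apply/kerP; first by rewrite groupR ?Ez ?ER.
    by rewrite morphR ?Ez ?ER // fR // fz //; apply/eqP/commgP/cRW.
  have cc := ker_commute cK Kc.
  apply/commgP/eqP; apply: (mulgI [~ R v x, z u]).
  rewrite mulg1 -expg2 -commgX; last exact/commute_sym/cc/Ez.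
  rewrite -[RHS](mulKg tau^-1) -(cc _ EtV) -conjgE conjRg zJ //.
  apply: (comm_ker_eq cK); rewrite ?groupX ?groupJ ?ER ?Ez //.
  rewrite morphJ ?ER ?fR //.
  by rewrite morphV // ftau -{2}(tR v x) // conjgK.
have RMl v v' x : v \in V -> v' \in V -> x \in W ->
  R (v * v') x = R v x * R v' x.
  move=> Vv Vv' Wx; rewrite /R sM // commMgJ -/(R v x); congr (_ * _).
  by apply/conjg_fixP/commgP/cRs.
have cRR v x v' x' : v \in V -> x \in W -> v' \in V -> x' \in W ->
    commute (R v x) (R v' x').
  move=> Vv Wx Vv' Wx'; rewrite {2}/R commgEl conjgE.
  have cs := cRs v x v' Vv Wx Vv'; have cz := cRz v x x' Vv Wx Wx'.
  by do ![apply: commuteM | apply: commuteV].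
have RMr v x x' : v \in V -> x \in W -> x' \in W ->
  R v (x * x') = R v x * R v x'.
  move=> Vv Wx Wx'; rewrite /R zM // commgMJ -/(R v x) -/(R v x').
  have /commgP/conjg_fixP-> := cRz v x x' Vv Wx Wx'; exact: cRR.
have zt x : x \in W -> z x ^ tau = z (x ^ t).
  move=> Wx; have [Wxt {1}<-] := tWV x Wx.
  by rewrite expg2 zM // -expg2 -zJ // conjgKV.
have Rt v x : v \in V -> x \in W -> commute (R v x) tau.
  move=> Vv Wx; apply/commgP/conjg_fixP; have [Wxt xt2] := tWV x Wx.
  rewrite conjRg sJ // zt // expg2 -sM // -[LHS]/(R _ _) RMl //.
  by rewrite -RMr // -expg2 xt2.
pose V' := (Morphism sM @* V)%G; pose W' := (Morphism zM @* W)%G.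
have V's v : v \in V -> s v \in V' by move=> Vv;
  apply: (mem_morphim (Morphism sM) Vv Vv).
have W'z x : x \in W -> z x \in W' by move=> Wx;
  apply: (mem_morphim (Morphism zM) Wx Wx).
have V'P a : a \in V' -> exists2 v, v \in V & a = s v by case/morphimP=>
  v _ Vv ->; exists v.
have W'P a : a \in W' -> exists2 x, x \in W & a = z x by case/morphimP=>
  x _ Wx ->; exists x.
pose Ys := [set \prod_i R (v i) (w i) | v : {ffun I -> rT} in ffun_on (mem V)].
have YsP (v : I -> rT) : (forall i, v i \in V) -> \prod_i R (v i) (w i) \in Ys.
  move=> Vv; apply/imsetP; exists (finfun v).
    by apply/ffun_onP=> i; rewrite ffunE; apply: Vv.
  by apply: eq_bigr => i _; rewrite ffunE.
have gYs : group_set Ys.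
  apply/group_setP; split.
    have <- : \prod_i R ((fun=> 1) i) (w i) = 1.
      apply: big1 => i _; rewrite /R.
      suff -> : s 1 = 1 by rewrite comm1g.
      by apply: (morph1 (Morphism sM)).
    by apply: YsP => i; apply: group1.
  move=> _ _ /imsetP[a /ffun_onP Va ->] /imsetP[b /ffun_onP Vb ->].
  rewrite prodgM_comm => [|i j]; last exact: cRR.
  have <- : \prod_i R (a i * b i) (w i) = \prod_i (R (a i) (w i) * R (b i) (w
    i)).
    by apply: eq_bigr => i _; rewrite RMl.
  by apply: (YsP (fun i => a i * b i)) => i; rewrite groupM.
pose Y := Group gYs.
have RY v x : v \in V -> x \in W -> R v x \in Y.
  (* By multiplicativity in x, the good x form a subgroup, so only the generators w i need checking;
     there the family is v at i and 1 elsewhere. *)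
  move=> Vv; pose WY := [set x in W | R v x \in Y].
  have gWY : group_set WY.
    apply/group_setP; split=> [|a b]; rewrite !inE ?group1 /=.
      suff -> : R v 1 = 1 by apply: (group1 Y).
      rewrite /R; suff -> : z 1 = 1 by rewrite commg1.
      by apply: (morph1 (Morphism zM)).
    case/andP=> Wa Ya /andP[Wb Yb]; rewrite groupM //= RMr //.
    exact: (@groupM _ Y).
  suff sWY : W \subset Group gWY by move/(subsetP sWY); rewrite inE => /andP[].
  apply: subset_trans genW _; rewrite gen_subG; apply/subsetP=>
    _ /imsetP[i _ ->].
  rewrite inE Ww /=.
  have <- : \prod_j R (if j == i then v else 1) (w j) = R v (w i).
    transitivity (\prod_(j | j == i) R v (w j)); last exact: big_pred1_eq.
    rewrite [RHS]big_mkcond.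
    apply: eq_bigr => j _; case: eqP => [->//|_].
    rewrite /R; suff -> : s 1 = 1 by rewrite comm1g.
    by apply: (morph1 (Morphism sM)).
  by apply: YsP => j; case: ifP; rewrite ?group1.
have cY g : (forall v x, v \in V -> x \in W -> commute (R v x) g) ->
    {in Y, forall y, commute y g}.
  move=> cRg _ /imsetP[v /ffun_onP Vv ->]; apply/commute_sym.
  by elim/big_rec: _ => [|i y _ cy]; [apply: commute1 | apply: commuteM; last
    by []; exact/commute_sym/cRg].
have cYV' : Y \subset 'C(V').
  apply/centsP=> y Yy _ /V'P[v Vv ->]; apply: cY Yy => a x Va Wx; exact: cRs.
have cYW' : Y \subset 'C(W').
  apply/centsP=> y Yy _ /W'P[v Vv ->]; apply: cY Yy => a x Va Wx; exact: cRz.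
have cYtau : {in Y, forall y, commute y tau} by apply: cY.
(* Conjugating z x by s v changes it only by a commutator in Y, and Y commutes with V'. *)
have nWYV' : V' \subset 'N(W' <*> Y).
  apply/subsetP=> _ /V'P[v Vv ->]; rewrite inE -genJ gen_subG conjUg subUset.
  apply/andP; split; apply/subsetP=> _ /imsetP[a Aa ->].
    have [x Wx ->] := W'P a Aa; rewrite conjg_mulR; apply: groupM.
      by rewrite (subsetP (joing_subl _ _)) ?W'z.
    by rewrite -invg_comm groupV (subsetP (joing_subr _ _)) //; apply: RY.
  have /commgP/conjg_fixP-> := centsP cYV' a Aa _ (V's v Vv).
  by rewrite mem_gen // inE Aa orbT.
pose Q := (V' <*> (W' <*> Y))%G.
have defQ : Q = V' * (W' * Y) :> {set gT}.
  transitivity (V' * (W' <*> Y)); first exact: norm_joinEl.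
  by rewrite cent_joinEr.
have sQE : Q \subset E.
  rewrite !join_subG; apply/and3P; split; apply/subsetP=> a.
  - by case/V'P=> v Vv ->; apply: Es.
  - by case/W'P=> v Vv ->; apply: Ez.
  case/imsetP=> v /ffun_onP Vv ->; apply: group_prod => i _.
  by apply: ER.
have sV'Q : V' \subset Q by apply: joing_subl.
have sW'Q : W' \subset Q by rewrite (subset_trans _ (joing_subr _ _))
  ?joing_subl.
have sYQ : Y \subset Q by rewrite (subset_trans _ (joing_subr _ _)) ?joing_subr.
have fQ : V <*> W \subset f @* Q.
  rewrite join_subG; apply/andP; split; apply/subsetP=> x Ax.
    by rewrite -(fs x Ax) mem_morphim ?Es ?(subsetP sV'Q) ?V's.
  by rewrite -(fz x Ax) mem_morphim ?Ez ?(subsetP sW'Q) ?W'z.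
have ntauV' : tau \in 'N(V').
  rewrite inE; apply/subsetP=> _ /imsetP[_ /V'P[v Vv ->] ->].
  by rewrite sJ // groupX // V's.
have ntauW' : tau \in 'N(W').
  rewrite inE; apply/subsetP=> _ /imsetP[_ /W'P[v Vv ->] ->].
  by rewrite zt // W'z; have [] := tWV v Vv.
have ntauY : tau \in 'N(Y).
  by apply: (subsetP (cent_sub _)); apply/centP=> y /cYtau/commute_sym.
have defE : E = ('ker f <*> Q) <*> <[tau]> :> {set gT}.
  have sKQE : 'ker f <*> Q \subset E by rewrite join_subG subsetIl sQE.
  have sTE : 'ker f <*> Q <*> <[tau]> \subset E.
    by rewrite join_subG sKQE cycle_subG.
  apply/eqP; rewrite eqEsubset sTE andbT.
  have sKT : 'ker f \subset 'ker f <*> Q <*> <[tau]>.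
    by rewrite -joingA joing_subl.
  apply: subset_trans (_ : f @*^-1 (f @* E) \subset _).
    by rewrite -sub_morphim_pre.
  rewrite fE -(mulSGid sKT) -morphimK //.
  apply: morphpreS; rewrite join_subG; apply/andP; split.
    apply: subset_trans fQ _; apply: morphimS.
    exact: subset_trans (joing_subr _ _) (joing_subl _ _).
  rewrite cycle_subG -ftau mem_morphim // (subsetP (joing_subr _ _)) ?cycle_id
    //.
have nQK : 'ker f \subset 'N(Q).
  rewrite (subset_trans _ (cent_sub _)) //.
  by rewrite (subset_trans (subset_trans cK (subsetIr _ _))) ?centS.
have nQtau : <[tau]> \subset 'N(Q).
  by do !apply: normsY; rewrite cycle_subG.
have nKQE : E \subset 'N('ker f <*> Q).
  apply: normsY; first exact: normal_norm (ker_normal f).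
  by rewrite defE join_subG nQtau andbT join_subG nQK; apply: normG.
have sKQE : 'ker f <*> Q \subset E by rewrite join_subG subsetIl sQE.
(* The quotient is generated by the image of the p'-element tau. *)
have p'KQ : p^'.-nat #|E : 'ker f <*> Q|.
  rewrite -card_quotient //.
  have -> : E / ('ker f <*> Q) = <[tau]> / ('ker f <*> Q).
    transitivity (('ker f <*> Q) <*> <[tau]> / ('ker f <*> Q)).
      by rewrite -defE.
    by rewrite quotientYidl // (subset_trans _ nKQE) // cycle_subG.
  have nKQtau := subsetP nKQE tau Et.
  by rewrite quotient_cycle //; apply: (morph_p_elt (coset_morphism _) nKQtau).
(* An element q = (s v)(z x) y of ker f is fixed by tau, and so is y. Comparing q with its conjugate
   gives s v = z (x^t). Since tau squares the left side and tau^-1 squares the right side, (s v)^4 =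
   s v, so s v = 1 because p is not 3. Then z x = 1 as well, q lies in Y, and [injR] gives q = 1. *)
have tiKQ : 'ker f :&: Q = 1.
  apply/trivgP/subsetP=> q /setIP[Kq]; rewrite -[in X in X -> _]/(q \in gval Q)
    defQ.
  case/mulsgP=> _ b /V'P[v Vv ->] /mulsgP[_ y /W'P[x Wx ->] Yy ->] def_q.
  have: q ^ tau = q by apply/conjg_fixP/commgP/(ker_commute cK).
  have /commgP/conjg_fixP yt := cYtau y Yy.
  rewrite def_q !conjMg yt sJ // zt // !mulgA => /mulIg svx.
  have [Wxt xt2] := tWV x Wx.
  have zx : z x = z (x ^ t) * z (x ^ t) by rewrite -zM // -expg2 xt2.
  have sz : s v = z (x ^ t).
    by move: svx; rewrite expg2 zx -!mulgA => /mulgI; move/mulIg.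
  have s1 : s v = 1.
    apply: (exp3_eq1 p3).
      exact: (morph_p_elt (Morphism sM) Vv (mem_p_elt pV Vv)).
    apply: (mulgI (s v)); rewrite -expgS mulg1.
    rewrite -[in RHS](conjgK tau (s v)) sJ // sz conjXg zJ // -expgM.
    by [].
  rewrite s1 zx -sz s1 !mul1g; move: Kq; rewrite def_q s1 zx -sz s1 !mul1g.
  case/imsetP: Yy => a /ffun_onP Va -> /mker.
  rewrite morph_prod => [|i _]; last exact: ER.
  under eq_bigr => i _ do rewrite fR //.
  move/(injR Va) => a1; rewrite big1 // => i _.
  rewrite a1 /R; suff -> : s 1 = 1 by rewrite comm1g.
  exact: (morph1 (Morphism sM)).
have nsKE : 'ker f <| E by apply: ker_normal.
have sKKQ : 'ker f \subset 'ker f <*> Q by apply: joing_subl.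
have abK : abelian ('ker f).
  by rewrite /abelian (subset_trans (subset_trans cK (subsetIr _ _))) ?centS
    ?subsetIl.
rewrite (Gaschutz_split nsKE sKKQ sKQE abK (pnat_coprime pK p'KQ)).
apply/splitsP; exists Q; apply/complP; split=> //.
exact/esym/norm_joinEl.
Qed.

Lemma heisenberg_pgood : pgood p H.
Proof. by split; [apply: heisenberg_gen | apply: heisenberg_split]. Qed.
End Heisenberg.

(** * Centralizers in automorphism groups of abelian p-groups *)

Section DualBasis.
Local Open Scope group_scope.

(** A / C is a vector space over F_p in which y is nonzero. Pick a coordinate i0 where y does not
    vanish, exchange the basis vector at i0 for y, and correct the other coordinates by the multiple
    of y that this introduces. *)
Lemma dual_basis (p : nat) (gT : finGroupType) (A C : {group gT}) (y : gT) :
    prime p -> abelian A -> C \subset A -> (forall x,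
      x \in A -> x ^+ p \in C) ->
    y \in A -> y \notin C ->
  exists (n : nat) (i0 : 'I_n) (a : 'I_n -> gT) (chi : 'I_n -> gT -> 'F_p),
    [/\ a i0 = y, (forall i, a i \in A),
        (forall i, {in A &, {morph chi i : x z / x * z >-> (x + z)%R}}),
        (forall i x, x \in C -> chi i x = 0%R)
      & (forall i j, chi i (a j) = (i == j)%:R%R)]
    /\ {in A, forall x, (forall i, chi i x = 0%R) -> x \in C}.
Proof.
move=> p_pr cAA sCA ApC Ay notCy.
have nCA : A \subset 'N(C) by rewrite sub_abelian_norm.
have abE : p.-abelem (A / C).
  rewrite abelemE // quotient_abelian //; apply/exponentP=>
    _ /morphimP[x Nx Ax ->].
  by rewrite -morphX //; apply: coset_id; apply: ApC.
have ntE : (A / C)%G != 1 :> {set _}.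
  apply/trivgPn; exists (coset C y); first exact: mem_quotient.
  by apply: contra notCy => /eqP/coset_idr-> //; apply: (subsetP nCA).
pose r := abelem_rV abE ntE; pose v x := r (coset C x).
have vM : {in A &, {morph v : x z / x * z >-> (x + z)%R}}.
  move=> x z Ax Az; rewrite /v morphM ?(subsetP nCA) // /r abelem_rV_M //;
  exact: mem_quotient.
have vC x : x \in C -> v x = 0%R.
  by move=> Cx; rewrite /v coset_id // /r abelem_rV_1.
have v_eq0 x : x \in A -> v x = 0%R -> x \in C.
  move=> Ax vx0; apply: coset_idr; first exact: (subsetP nCA).
  apply: (@abelem_rV_inj _ _ _ abE ntE); rewrite ?mem_quotient ?group1 //.
  by rewrite abelem_rV_1.
have v_onto u : exists2 x, x \in A & v x = u.
  have := mem_rVabelem abE ntE u; case/morphimP=> x _ Ax def_x.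
  by exists x; rewrite // /v -def_x /r rVabelemK.
have /rV0Pn[i0 vyi0] : v y != 0%R by apply: contra notCy => /eqP/(v_eq0 y Ay).
pose e i := if i == i0 then v y else delta_mx ord0 i.
(* The default y is never taken by [odflt], since v is onto. *)
pose a i := if i == i0 then y else
  odflt y [pick x in A | v x == delta_mx ord0 i].
have aP i : a i \in A /\ v (a i) = e i.
  rewrite /a /e; case: eqP => // _; case: pickP => [x /andP[Ax /eqP]//|] /=.
  by have [x Ax vx] := v_onto (delta_mx ord0 i) => /(_ x); rewrite Ax vx eqxx.
pose c x := (v x ord0 i0 / v y ord0 i0)%R.
exists _, i0, a, (fun i x => if i == i0 then c x
  else v x ord0 i - c x * v y ord0 i)%R; split; [split|].
- by rewrite /a eqxx.
- by move=> i; have [] := aP i.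
- move=> i x z Ax Az /=; rewrite /c vM // !mxE.
  by case: eqP => _; rewrite ?mulrDl // opprD addrACA.
- by move=> i x Cx; rewrite /c vC // !mxE !mul0r subr0 if_same.
- move=> i j; rewrite /c; have [_ ->] := aP j; rewrite /e.
  have [-> | ni] := eqVneq i i0; have [j0 | nj] := eqVneq j i0; rewrite ?j0.
  - by rewrite divff.
  - by rewrite mxE eqxx /= eq_sym (negPf nj) mul0r.
  - by rewrite divff // mul1r subrr (negPf ni).
  - by rewrite !mxE eqxx /= [i0 == j]eq_sym (negPf nj) !mul0r subr0.
move=> x Ax chi0; apply: v_eq0 => //; apply/rowP=> i; rewrite [RHS]mxE.
have cx0 : c x = 0%R by have := chi0 i0; rewrite eqxx.
have := chi0 i; case: eqP => [-> _ | _]; last by rewrite cx0 mul0r subr0.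
by move/eqP: cx0; rewrite mulf_eq0 invr_eq0 (negPf vyi0) orbF => /eqP.
Qed.
End DualBasis.

Section FpPower.
Local Open Scope group_scope.
Variables (p : nat) (gT : finGroupType) (d : gT).
Hypotheses (p_pr : prime p) (dp : d ^+ p = 1).

Lemma expg_natFp k : d ^+ (k%:R%R : 'F_p) = d ^+ k.
Proof. by rewrite /= val_Fp_nat // expg_mod. Qed.

Lemma expgFpD (a b : 'F_p) : d ^+ (a + b)%R = d ^+ a * d ^+ b.
Proof. by rewrite -[in LHS](natr_Zp a) -[in LHS](natr_Zp b) -natrD expg_natFp
  expgD. Qed.

Lemma expgFpM (a b : 'F_p) : d ^+ (a * b)%R = d ^+ a ^+ b.
Proof. by rewrite -[in LHS](natr_Zp a) -[in LHS](natr_Zp b) -natrM expg_natFp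
  expgM. Qed.

End FpPower.

Section Transvections.
Local Open Scope group_scope.

Variables (p : nat) (gT : finGroupType) (A C : {group gT}).
Hypotheses (p_pr : prime p) (cAA : abelian A) (sCA : C \subset A).

Definition is_char (c : gT -> 'F_p) :=
  {in A &, {morph c : x z / x * z >-> (x + z)%R}} /\
  {in C, forall x, c x = 0%R}.

Lemma charX c x k : is_char c -> x \in A -> c (x ^+ k) = (c x *+ k)%R.
Proof.
case=> cM c0 Ax; elim: k => [|k IHk]; first by rewrite c0 ?group1.
by rewrite expgS cM ?groupX // IHk mulrS.
Qed.

Lemma charF c x (k : 'F_p) : is_char c -> x \in A -> c (x ^+ k) = (k * c x)%R.
Proof. by move=> cc Ax; rewrite charX // -mulr_natl natr_Zp. Qed.

(* The default value 1 is only taken when x |-> x d^(c x) does not restrict   *)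
(* to an automorphism of A.                                                   *)
Definition transvection (d : gT) (c : gT -> 'F_p) : {perm gT} :=
  odflt 1 [pick phi in Aut A | [forall x in A, phi x == x * d ^+ c x]].

(** Applying c to x d^(c x) gives (c x)(1 + c d). When 1 + c d is nonzero, c x can be recovered,
    hence also x, so the map is injective and thus onto. *)
Lemma transvectionP d c : is_char c -> d \in A -> d ^+ p = 1 ->
  (1 + c d != 0)%R ->
  transvection d c \in Aut A /\
  {in A, forall x, transvection d c x = x * d ^+ c x}.
Proof.
move=> cc Ad dp nz; have [cM c0] := cc.
rewrite /transvection; case: pickP => [phi /andP[Aphi /forall_inP phiE]|] /=.
  by split=> // x /phiE/eqP.
have fM : {in A &, {morph (fun x => x * d ^+ c x) : x z / x * z}}.
  move=> x z Ax Az /=; rewrite cM // expgFpD // -!mulgA; congr (_ * _).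
  by rewrite !mulgA; congr (_ * _); apply: (centsP cAA); rewrite ?groupX.
have injf : 'injm (Morphism fM).
  apply/injmP=> x z Ax Az /= eq_xz.
  have: c (x * d ^+ c x) = c (z * d ^+ c z) by rewrite eq_xz.
  rewrite !cM ?groupX // !charF // -{1}[c x]mulr1 -{1}[c z]mulr1 -!mulrDr.
  by move/(mulIf nz) => cxz; move: eq_xz; rewrite cxz => /mulIg.
have fA : Morphism fM @* A = A.
  apply/eqP; rewrite eqEcard card_injm // leqnn andbT.
  by apply/subsetP=> _ /morphimP[x _ Ax ->]; rewrite /= groupM ?groupX.
move/(_ (aut injf fA)); rewrite Aut_aut /= => /forall_inP[] x Ax.
by rewrite autE.
Qed.

Lemma transvection_fix d c : is_char c -> d \in A -> d ^+ p = 1 ->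
  (1 + c d != 0)%R ->
  transvection d c \in 'C_(Aut A)(C | 'P).
Proof.
move=> cc Ad dp nz; have [At tE] := transvectionP cc Ad dp nz.
rewrite inE At; apply/astabP=> x Cx; rewrite /= apermE tE ?(subsetP sCA) //.
by have [_ ->] := cc; rewrite // mulg1.
Qed.

End Transvections.

Section CentralizerAut.
Local Open Scope group_scope.

Variables (p : nat) (gT : finGroupType) (A C : {group gT}) (y : gT).
Hypotheses (p_pr : prime p) (p2 : p <> 2) (p3 : p <> 3).
Hypotheses (cAA : abelian A) (sCA : C \subset A).
Hypotheses (ApC : forall x, x \in A -> x ^+ p \in C).
Hypotheses (Ay : y \in A) (yp : y ^+ p = 1).
Hypothesis Ohm_sub : forall x, x \in A -> x ^+ p = 1 -> x \in C * <[y]>.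

(* a and chi are dual bases of A / C, with y = a i0.                          *)
Variables (n : nat) (i0 : 'I_n) (a : 'I_n -> gT) (chi : 'I_n -> gT -> 'F_p).
Hypotheses (a0 : a i0 = y) (Aa : forall i, a i \in A).
Hypothesis chiM : forall i, {in A &, {morph chi i : x z / x * z >-> (x + z)%R}}.
Hypothesis chiC : forall i x, x \in C -> chi i x = 0%R.
Hypothesis chia : forall i j, chi i (a j) = (i == j)%:R%R.
Hypothesis chi_inj : {in A, forall x, (forall i, chi i x = 0%R) -> x \in C}.

Let T := transvection A (p := p).
Let cF := @charF p gT A C.
Let kap := chi i0.

Definition chi_comb (m : {ffun 'I_n -> 'F_p}) x := (\sum_i m i * chi i x)%R.

Lemma chi_char i : is_char A C (chi i).
Proof. by split=> [|x Cx]; [apply: chiM | apply: chiC]. Qed.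
Hint Resolve chi_char : core.

Lemma chi_comb_char m : is_char A C (chi_comb m).
Proof.
split=> [x z Ax Az | x Cx]; rewrite /chi_comb.
  by rewrite -big_split; apply: eq_bigr => i _; rewrite chiM // mulrDr.
by rewrite big1 // => i _; rewrite chiC ?mulr0.
Qed.
Hint Resolve chi_comb_char : core.

Lemma chi_comb_a m j : chi_comb m (a j) = m j.
Proof.
rewrite /chi_comb (bigD1 j) //= chia eqxx mulr1 big1 ?addr0 // => i nij.
by rewrite chia (negPf nij) mulr0.
Qed.

Lemma kapM : {in A &, {morph kap : x z / x * z >-> (x + z)%R}}.
Proof. exact: chiM. Qed.

Lemma kapF x (k : 'F_p) : x \in A -> kap (x ^+ k) = (k * kap x)%R.
Proof. by move=> Ax; apply: (charF k (chi_char i0) Ax). Qed.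

Lemma kap_char : is_char A C kap. Proof. exact: chi_char. Qed.

Lemma kapC x : x \in C -> kap x = 0%R.
Proof. exact: chiC. Qed.

Lemma kap_y : kap y = 1%R. Proof. by rewrite /kap -a0 chia eqxx. Qed.

Lemma nz1 : (1 + 0 != 0 :> 'F_p)%R. Proof. by rewrite addr0 oner_neq0. Qed.

Lemma two_neq0 : (1 + 1 != 0 :> 'F_p)%R.
Proof.
have -> : (1 + 1 = 2%:R :> 'F_p)%R by rewrite -natr1.
rewrite -(dvdn_pcharf (pchar_Fp p_pr)); rewrite dvdn_prime2 //; exact/eqP.
Qed.

Lemma prod_A (k : 'I_n -> 'F_p) : \prod_j a j ^+ k j \in A.
Proof. by apply: group_prod => j _; rewrite groupX. Qed.

Lemma chi_prod i (k : 'I_n -> 'F_p) : chi i (\prod_j a j ^+ k j) = k i.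
Proof.
have -> : k i = (\sum_j chi i (a j ^+ k j))%R.
  rewrite (bigD1 i) //= cF // chia eqxx mulr1 big1 ?addr0 // => j nij.
  by rewrite cF // chia eq_sym (negPf nij) mulr0.
elim: (index_enum _) => [|j r IHr]; first by rewrite !big_nil chiC.
by rewrite !big_cons chiM ?IHr ?groupX // group_prod // => l _; rewrite groupX.
Qed.

(** A is generated by C and the a j, so automorphisms can be compared on these alone. *)
Lemma Aut_expand x : x \in A -> exists2 c, c \in C &
  forall phi, phi \in Aut A -> phi x = phi c * \prod_j phi (a j) ^+ chi j x.
Proof.
move=> Ax; have Ap := prod_A (fun j => chi j x).
exists (x * (\prod_j a j ^+ chi j x)^-1).
  apply: chi_inj; rewrite ?groupM ?groupV // => i.
  have /(congr1 (chi i)) := mulgKV (\prod_j a j ^+ chi j x) x.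
  rewrite chiM ?groupM ?groupV // chi_prod -{2}[chi i x]add0r.
  exact: addIr.
move=> phi Aphi; rewrite -(autmE Aphi) -{1}(mulgKV (\prod_j a j ^+ chi j x) x).
rewrite morphM ?groupM ?groupV // morph_prod => [|j _]; last by rewrite groupX.
by congr (_ * _); apply: eq_bigr => j _; rewrite morphX.
Qed.

Lemma eq_Aut_basis phi psi : phi \in Aut A -> psi \in Aut A ->
  {in C, phi =1 psi} -> (forall j, phi (a j) = psi (a j)) -> phi = psi.
Proof.
move=> Aphi Apsi eqC eqa; apply: (eq_Aut Aphi Apsi) => x Ax.
have [c Cc cE] := Aut_expand Ax; rewrite !cE // eqC //; congr (_ * _).
by apply: eq_bigr => j _; rewrite eqa.
Qed.

Definition unit_coef (i : 'I_n) : {ffun 'I_n -> 'F_p} := [ffun j =>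
  (j == i)%:R%R].

Lemma chi_comb_unit i x : chi_comb (unit_coef i) x = chi i x.
Proof.
rewrite /chi_comb (bigD1 i) //= ffunE eqxx mul1r big1 ?addr0 // => j nij.
by rewrite ffunE (negPf nij) mul0r.
Qed.

Lemma chi_combD m m' x : chi_comb (m + m')%R x = (chi_comb m x + chi_comb m'
  x)%R.
Proof. by rewrite /chi_comb -big_split; apply: eq_bigr => i _;
  rewrite ffunE mulrDl. Qed.

Definition socle := [set d in C | d ^+ p == 1].

Lemma socleP d : d \in socle -> [/\ d \in C, d \in A & d ^+ p = 1].
Proof. by case/setIdP=> Cd /eqP; rewrite (subsetP sCA). Qed.

Lemma T_socleP c d : is_char A C c -> d \in socle ->
  T d c \in Aut A /\ {in A, forall x, T d c x = x * d ^+ c x}.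
Proof.
move=> cc /socleP[Cd Ad dp]; apply: (transvectionP p_pr cAA cc Ad dp).
by have [_ ->] := cc; rewrite ?nz1.
Qed.

Lemma T_yP c : is_char A C c -> c y = 0%R ->
  T y c \in Aut A /\ {in A, forall x, T y c x = x * y ^+ c x}.
Proof.
by move=> cc c0; apply: (transvectionP p_pr cAA cc Ay yp); rewrite c0 nz1.
Qed.

(** [upper_set] is V = Hom(<y>, C[p]), acting by y |-> y d; [lower_set] is W = Hom(A / (C + <y>),
    <y>), since m i0 = 0 says that the linear form vanishes at y; [doubling] is the automorphism t
    with y |-> y^2. *)
Definition upper_set := [set T d kap | d in socle].
Definition lower_set := [set T y (chi_comb m) | m in [set m : {ffun 'I_n ->
  'F_p} | m i0 == 0%R]].
Definition doubling := T y kap.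

Lemma chi_comb_y (m : {ffun 'I_n -> 'F_p}) : chi_comb m y = m i0.
Proof. by rewrite -a0 chi_comb_a. Qed.

Lemma doublingP : doubling \in Aut A /\ {in A, forall x,
  doubling x = x * y ^+ kap x}.
Proof.
apply: (transvectionP p_pr cAA (chi_char i0) Ay yp).
by rewrite [X in (1 + X)%R]kap_y two_neq0.
Qed.

Lemma TdM d d' c : is_char A C c -> d \in socle -> d' \in socle ->
  T d c * T d' c = T (d * d') c.
Proof.
move=> cc Dd Dd'; have [Cd Ad dp] := socleP Dd; have [Cd' Ad' dp'] :=
  socleP Dd'.
have Ddd' : d * d' \in socle.
  rewrite inE groupM //= expgMn ?dp ?dp' ?mulg1 //; exact: (centsP cAA).
have [[At tE] [At' tE']] := (T_socleP cc Dd, T_socleP cc Dd').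
have [At2 tE2] := T_socleP cc Ddd'; have [cM c0] := cc.
apply: (eq_Aut (groupM At At') At2) => x Ax.
rewrite permM tE // tE' ?groupM ?groupX // tE2 // cM ?groupX // cF // (c0 d) //.
by rewrite mulr0 addr0 -mulgA expgMn //; apply: (centsP cAA).
Qed.

Lemma TcM c c' c2 : is_char A C c -> is_char A C c' -> is_char A C c2 ->
  c y = 0%R -> c' y = 0%R -> (forall x, c2 x = c x + c' x)%R ->
  T y c * T y c' = T y c2.
Proof.
move=> cc cc' cc2 cy cy' c2E.
have c2y : c2 y = 0%R by rewrite c2E cy cy' addr0.
have [[At tE] [At' tE']] := (T_yP cc cy, T_yP cc' cy').
have [At2 tE2] := T_yP cc2 c2y; have [cM c0] := cc'.
apply: (eq_Aut (groupM At At') At2) => x Ax.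
rewrite permM tE // tE' ?groupM ?groupX // tE2 // cM ?groupX // cF // cy' //.
by rewrite mulr0 addr0 -mulgA c2E expgFpD.
Qed.

Lemma upper_group_set : group_set upper_set.
Proof.
apply/group_setP; split.
  have D1 : 1 \in socle by rewrite inE group1 expg1n eqxx.
  apply/imsetP; exists 1 => //; have [At tE] := T_socleP kap_char D1.
  by apply: (eq_Aut (group1 _) At) => x Ax; rewrite perm1 tE // expg1n mulg1.
move=> _ _ /imsetP[d Dd ->] /imsetP[d' Dd' ->]; rewrite (TdM kap_char) //.
have [Cd Ad dp] := socleP Dd; have [Cd' Ad' dp'] := socleP Dd'.
apply/imsetP; exists (d * d') => //.
rewrite inE groupM //= expgMn ?dp ?dp' ?mulg1 //; exact: (centsP cAA).
Qed.

Lemma lower_group_set : group_set lower_set.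
Proof.
apply/group_setP; split.
  apply/imsetP; exists 0%R; first by rewrite inE ffunE.
  have [|At tE] := T_yP (chi_comb_char 0%R); first by rewrite chi_comb_y ffunE.
  apply: (eq_Aut (group1 _) At) => x Ax; rewrite perm1 tE //.
  by rewrite /chi_comb big1 ?mulg1 // => i _; rewrite ffunE mul0r.
move=> _ _ /imsetP[m /[!inE] /eqP m0 ->] /imsetP[m' /[!inE] /eqP m'0 ->].
rewrite (TcM (c2 := chi_comb (m + m')%R)) ?chi_comb_y // => [|x];
  last exact: chi_combD.
by apply/imsetP; exists (m + m')%R; rewrite // inE ffunE m0 m'0 addr0.
Qed.

Definition upper := Group upper_group_set.
Definition lower := Group lower_group_set.

Lemma doublingX k : {in A, forall x, (doubling ^+ k) x = x * y ^+ (((1 + 1) ^+ k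
  - 1) * kap x)%R}.
Proof.
have [At tE] := doublingP; move=> x Ax; elim: k => [|k IHk].
  by rewrite expg0 perm1 expr0 subrr mul0r mulg1.
rewrite expgSr permM IHk tE ?groupM ?groupX // kapM ?groupX //.
rewrite kapF // kap_y mulr1 -mulgA -expgFpD //.
by congr (_ * y ^+ nat_of_ord _); rewrite exprSr; ring.
Qed.

(** Powers of [doubling] multiply y by powers of 2, so Fermat's little theorem bounds its order by a
    divisor of p - 1. *)
Lemma doubling_p'_elt : p^'.-elt doubling.
Proof.
have [At tE] := doublingP.
have t1 : doubling ^+ p.-1 = 1.
  apply: (eq_Aut (groupX _ At) (group1 _)) => x Ax; rewrite doublingX // perm1.
  have -> : ((1 + 1) ^+ p.-1 = 1 :> 'F_p)%R.
    by apply: (mulfI two_neq0); rewrite -exprS prednK ?prime_gt0 // -[X in (_ ^+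
      X)%R](card_Fp p_pr) expf_card mulr1.
  by rewrite subrr mul0r mulg1.
rewrite /p_elt; apply: pnat_dvd (_ : p^'.-nat p.-1); first
  by rewrite order_dvdn t1.
rewrite p'natE // gtnNdvd //; first by case: p p_pr => [|[|]].
by rewrite prednK ?prime_gt0.
Qed.

(** [doubling] fixes d in C and doubles the form [kap]. *)
Lemma doubling_upper v : v \in upper_set -> v ^ doubling^-1 = v ^+ 2.
Proof.
case/imsetP=> d Dd ->; have [Cd Ad dp] := socleP Dd.
have [At tE] := doublingP; have [Ad1 dE] := T_socleP kap_char Dd.
apply: (conjg_inj doubling); rewrite conjgKV conjgE; apply: (mulgI doubling).
rewrite mulKVg; apply: (eq_Aut (A := A)); rewrite ?groupM ?groupX // => x Ax.
have [c0] : kap d = 0%R by rewrite kapC.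
rewrite expg2 !permM tE // !dE ?groupM ?groupX // tE ?groupM ?groupX //.
rewrite !(kapM, kapF) ?groupM ?groupX // kap_y c0.
rewrite !mulr0 !addr0 mulr1 expgFpD // -!mulgA; congr (_ * _).
rewrite [RHS]mulgA; by apply: (centsP cAA); rewrite ?groupM ?groupX.
Qed.

(** [doubling] squares y and leaves unchanged a linear form that vanishes at y. *)
Lemma doubling_lower w : w \in lower_set -> w ^ doubling^-1^-1 = w ^+ 2.
Proof.
case/imsetP=> m /[!inE] /eqP m0 ->; have my : chi_comb m y = 0%R
  by rewrite chi_comb_y.
have [At tE] := doublingP; have [Aw wE] := T_yP (chi_comb_char m) my.
have [lM _] := chi_comb_char m.
rewrite invgK conjgE; apply: (mulgI doubling); rewrite mulKVg.
apply: (eq_Aut (A := A)); rewrite ?groupM ?groupX // => x Ax.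
rewrite expg2 !permM wE // tE ?groupM ?groupX // tE // !wE ?groupM ?groupX //.
rewrite !(kapM, kapF, lM, charF _ (chi_comb_char m)) ?groupM ?groupX // kap_y
  my.
rewrite !mulr0 !addr0 mulr1 expgFpD // -!mulgA; congr (_ * _).
by rewrite !mulgA; congr (_ * _); apply: (centsP cAA); rewrite ?groupM ?groupX.
Qed.

Lemma socleV d : d \in socle -> d^-1 \in socle.
Proof. by case/socleP=> Cd _ dp; rewrite inE groupV Cd expgVn dp invg1 /=. Qed.

(** This identifies commutators of V and W with the pure tensors of C[p] and the linear forms
    vanishing at y. They fix y, which makes them central in <V, W>. *)
Lemma comm_TdTy d (m : {ffun 'I_n -> 'F_p}) : d \in socle -> m i0 = 0%R ->
  [~ T d kap, T y (chi_comb m)] = T d^-1 (chi_comb m).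
Proof.
move=> Dd m0; have my : chi_comb m y = 0%R by rewrite chi_comb_y.
have [Cd Ad dp] := socleP Dd; have [lM l0] := chi_comb_char m.
have [Aw wE] := T_yP (chi_comb_char m) my; have [Av vE] := T_socleP kap_char Dd.
have [Az zE] := T_socleP (chi_comb_char m) (socleV Dd).
apply: (mulgI (T y (chi_comb m) * T d kap)).
have -> : T y (chi_comb m) * T d kap * [~ T d kap,
  T y (chi_comb m)] = T d kap * T y (chi_comb m).
  by rewrite commgEl conjgE !mulgA mulgK mulgV mul1g.
apply: (eq_Aut (A := A)); rewrite ?groupM ?groupX // => x Ax.
rewrite !permM wE // vE ?groupM ?groupX // vE // wE ?groupM ?groupX // zE
  ?groupM ?groupX //.
rewrite !(kapM, kapF, lM, charF _ (chi_comb_char m)) ?groupM ?groupX // kap_y my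
  (l0 d) //.
rewrite !mulr0 !addr0 mulr1 expgFpD // expgVn.
rewrite -!mulgA mulgV mulg1; congr (_ * _).
by apply: (centsP cAA); rewrite groupX.
Qed.

Lemma T_commute d c d' c' :
    is_char A C c -> is_char A C c' -> d \in A -> d' \in A ->
    T d c \in Aut A /\ {in A, forall x, T d c x = x * d ^+ c x} ->
    T d' c' \in Aut A /\ {in A, forall x, T d' c' x = x * d' ^+ c' x} ->
    c d' = 0%R -> c' d = 0%R ->
  commute (T d c) (T d' c').
Proof.
move=> cc cc' Ad Ad' [At tE] [At' tE'] cd' c'd; have [[cM _] [cM' _]] := (cc,
  cc').
apply: (eq_Aut (A := A)); rewrite ?groupM // => x Ax.
rewrite !permM (tE x) // (tE' x) // tE ?tE' ?groupM ?groupX //.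
rewrite cM ?cM' ?groupX // (charF _ cc') // (charF _ cc) // cd' c'd !mulr0
  !addr0.
by rewrite -!mulgA; congr (_ * _); apply: (centsP cAA); rewrite groupX.
Qed.

Lemma prod_T (J : Type) (r : seq J) (d : J -> gT) (m : J -> {ffun 'I_n ->
  'F_p}) :
  (forall j, d j \in socle) -> \prod_(j <- r) T (d j) (chi_comb (m j)) \in Aut A
    /\
  {in A, forall x, (\prod_(j <- r) T (d j) (chi_comb (m j))) x =
                   x * \prod_(j <- r) d j ^+ chi_comb (m j) x}.
Proof.
move=> Dd; have TP j := T_socleP (chi_comb_char (m j)) (Dd j).
split=> [|x Ax]; first by apply: group_prod => j _; have [] := TP j.
elim: r x Ax => [|j r IHr] x Ax; first by rewrite !big_nil perm1 mulg1.
have [Cj Aj dj] := socleP (Dd j); have [_ tE] := TP j.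
rewrite !big_cons permM tE // IHr ?groupM ?groupX // -mulgA;
  congr (_ * (_ * _)).
apply: eq_bigr => i _; have [lM l0] := chi_comb_char (m i).
by rewrite lM ?groupX // (charF _ (chi_comb_char _)) // (l0 (d j)) // mulr0
  addr0.
Qed.

Definition basis_idx := {i : 'I_n | i != i0}.
Definition lower_gen (i : basis_idx) : {perm gT} :=
  T y (chi_comb (unit_coef (val i))).

Lemma lower_gen_in i : lower_gen i \in lower.
Proof.
apply/imsetP; exists (unit_coef (val i)) => //; rewrite inE ffunE.
by rewrite [i0 == _]eq_sym (negPf (valP i)).
Qed.

Lemma gen_lower : lower \subset <<[set lower_gen i | i in {: basis_idx}]>>.
Proof.
pose P (m : {ffun 'I_n -> 'F_p}) := m i0 = 0%R /\
  T y (chi_comb m) \in <<[set lower_gen i | i in {: basis_idx}]>>.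
have P0 : P 0%R.
  split; first by rewrite ffunE.
  suff -> : T y (chi_comb 0%R) = 1 by apply: group1.
  have [|At tE] := T_yP (chi_comb_char 0%R); first by rewrite chi_comb_y ffunE.
  apply: (eq_Aut At (group1 _)) => x Ax; rewrite perm1 tE //.
  by rewrite /chi_comb big1 ?mulg1 // => i _; rewrite ffunE mul0r.
have PD m m' : P m -> P m' -> P (m + m')%R.
  move=> [m0 Tm] [m'0 Tm']; split; first by rewrite ffunE m0 m'0 addr0.
  rewrite -(TcM (chi_comb_char m) (chi_comb_char m') (chi_comb_char _))
    ?chi_comb_y ?groupM //.
  exact: chi_combD.
have Pe i k : i != i0 -> P (unit_coef i *+ k)%R.
  move=> ni; elim: k => [|k IHk]; first by rewrite mulr0n.
  rewrite mulrS; apply: PD => //; split.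
    by rewrite ffunE eq_sym (negPf ni).
  apply/mem_gen/imsetP; exists (Sub i ni) => //.
apply/subsetP=> _ /imsetP[m /[!inE] /eqP m0 ->].
suff [] : P m by [].
have -> : m = (\sum_(i | i != i0) unit_coef i *+ m i)%R.
  apply/ffunP=> j; rewrite sum_ffunE.
  have -> : (\sum_(i | i != i0) (unit_coef i *+ m i) j = \sum_(i | i != i0) (if
    i == j then m j else 0))%R.
    apply: eq_bigr => i _; rewrite ffunMnE ffunE [j == i]eq_sym.
    by case: eqP => [->|_]; rewrite ?natr_Zp ?mul0rn.
  rewrite -big_mkcondr /=; have [-> | nj] := eqVneq j i0.
    by rewrite m0 big_pred0 // => i; case: eqP.
  rewrite (big_pred1 j) // => i /=; case: (eqVneq i j) => [->|];
    rewrite ?nj ?andbF //.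
by apply: big_ind => // i ni; apply: Pe.
Qed.

(** The product of commutators multiplies the basis element a i by the inverse of d i alone, so if
    it is the identity then every d i is 1. *)
Lemma comm_inj (v : basis_idx -> {perm gT}) : (forall i, v i \in upper) ->
  \prod_i [~ v i, lower_gen i] = 1 -> forall i, v i = 1.
Proof.
move=> Vv; have /fin_all_exists[d dE] i : exists d,
  d \in socle /\ v i = T d kap.
  by have /imsetP[d Dd ->] := Vv i; exists d.
have Dd i : (d i)^-1 \in socle by apply: socleV; have [] := dE i.
under eq_bigr => i _.
  have [Di ->] := dE i; rewrite comm_TdTy //; last first.
    by rewrite ffunE [i0 == _]eq_sym (negPf (valP i)).
  over.
move=> prod1 i; have [Di ->] := dE i.
have [_ /(_ (a (val i)) (Aa _))] := prod_T (index_enum _) (fun i =>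
  unit_coef (val i)) Dd.
rewrite prod1 perm1 -[LHS]mulg1 => /mulgI.
have -> : \prod_j (d j)^-1 ^+ chi_comb (unit_coef (val j)) (a (val i)) = (d
  i)^-1.
  transitivity (\prod_(j | j == i) (d j)^-1); last exact: big_pred1_eq.
  rewrite [RHS]big_mkcond; apply: eq_bigr => j _.
  by rewrite chi_comb_unit chia (inj_eq val_inj); case: eqP.
move/eqP; rewrite eq_sym invg_eq1 => /eqP ->.
have D1 : 1 \in socle by rewrite inE group1 expg1n eqxx.
have [At tE] := T_socleP kap_char D1.
by apply: (eq_Aut At (group1 _)) => x Ax; rewrite perm1 tE // expg1n mulg1.
Qed.

Lemma T_X d c k : is_char A C c -> d \in A -> c d = 0%R ->
    T d c \in Aut A /\ {in A, forall x, T d c x = x * d ^+ c x} ->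
  {in A, forall x, (T d c ^+ k) x = x * (d ^+ c x) ^+ k}.
Proof.
move=> cc Ad c0 [At tE] x Ax; elim: k => [|k IHk]; first by rewrite perm1 mulg1.
have [cM _] := cc; rewrite expgSr permM IHk tE ?groupM ?groupX //.
by rewrite cM ?groupX // (charX _ cc) ?groupX // (charX _ cc) // c0 !mul0rn
  addr0 -mulgA -expgSr.
Qed.

Lemma upper_abelem : p.-abelem upper.
Proof.
rewrite abelemE //; apply/andP; split.
  apply/centsP=> _ /imsetP[d Dd ->] _ /imsetP[d' Dd' ->].
  have [[Cd Ad _] [Cd' Ad' _]] := (socleP Dd, socleP Dd').
  have [TP TP'] := (T_socleP kap_char Dd, T_socleP kap_char Dd').
  by apply: (T_commute kap_char kap_char _ _ TP TP'); rewrite ?kapC.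
apply/exponentP=> _ /imsetP[d Dd ->]; have [Cd Ad dp] := socleP Dd.
have TP := T_socleP kap_char Dd; have [At tE] := TP.
apply: (eq_Aut (groupX _ At) (group1 _)) => x Ax.
by rewrite (T_X _ kap_char) ?(kapC Cd) // -expgM mulnC expgM dp expg1n mulg1
  perm1.
Qed.

Lemma lower_abelem : p.-abelem lower.
Proof.
rewrite abelemE //; apply/andP; split.
  apply/centsP=> _ /imsetP[m /[!inE] /eqP m0 ->] _ /imsetP[m' /[!inE] /eqP m'0
    ->].
  have [my m'y] : chi_comb m y = 0%R /\ chi_comb m' y = 0%R
    by rewrite !chi_comb_y.
  have [TP TP'] := (T_yP (chi_comb_char m) my, T_yP (chi_comb_char m') m'y).
  by apply: (T_commute (chi_comb_char m) (chi_comb_char m') _ _ TP TP').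
apply/exponentP=> _ /imsetP[m /[!inE] /eqP m0 ->].
have my : chi_comb m y = 0%R by rewrite chi_comb_y.
have TP := T_yP (chi_comb_char m) my; have [At tE] := TP.
apply: (eq_Aut (groupX _ At) (group1 _)) => x Ax.
by rewrite (T_X _ (chi_comb_char m)) // -expgM mulnC expgM yp expg1n mulg1
  perm1.
Qed.

(** The inverse of [doubling] appears because conjugation by it squares V, while conjugation by
    [doubling] squares W, as the Heisenberg section requires of t and t^-1. *)
Definition heis := (upper <*> lower <*> <[doubling^-1]>)%G.

Lemma heis_pgood : pgood p heis.
Proof.
have RP v w : v \in upper -> w \in lower -> exists d (m : {ffun 'I_n -> 'F_p}),
    [/\ d \in socle, m i0 = 0%R & [~ v, w] = T d (chi_comb m)].
  case/imsetP=> d Dd -> /imsetP[m /[!inE] /eqP m0 ->].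
  by exists d^-1, m; split; rewrite ?socleV // comm_TdTy.
apply: (@heisenberg_pgood p _ upper lower doubling^-1 _ lower_gen).
- by rewrite p'natE // dvdn_prime2 //; apply/eqP.
- exact: abelem_pgroup upper_abelem.
- exact: abelem_abelian upper_abelem.
- exact: abelem_abelian lower_abelem.
- by rewrite p_eltV doubling_p'_elt.
- exact: doubling_upper.
- exact: doubling_lower.
- move=> v w Vv Ww _ /imsetP[d' Dd' ->]; have [d [m [Dd m0 ->]]] :=
  RP v w Vv Ww.
  have [[Cd Ad _] [Cd' Ad' _]] := (socleP Dd, socleP Dd').
  have [TP TP'] := (T_socleP (chi_comb_char m) Dd, T_socleP kap_char Dd').
  apply: (T_commute (chi_comb_char m) kap_char _ _ TP TP'); rewrite ?kapC //.
  by have [_ ->] := chi_comb_char m.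
- move=> v w Vv Ww _ /imsetP[m' /[!inE] /eqP m'0 ->].
  have [d [m [Dd m0 ->]]] := RP v w Vv Ww; have [Cd Ad _] := socleP Dd.
  have m'y : chi_comb m' y = 0%R by rewrite chi_comb_y.
  have [TP TP'] := (T_socleP (chi_comb_char m) Dd, T_yP (chi_comb_char m') m'y).
  apply: (T_commute (chi_comb_char m) (chi_comb_char m') _ _ TP TP');
    rewrite ?chi_comb_y //.
  by have [_ ->] := chi_comb_char m'.
- exact: lower_gen_in.
- exact: gen_lower.
exact: comm_inj.
Qed.

Lemma heis_sub : heis \subset 'C_(Aut A)(C | 'P).
Proof.
rewrite !join_subG cycle_subG groupV; apply/andP; split; first (apply/andP;
  split).
- apply/subsetP=> _ /imsetP[d Dd ->]; have [Cd Ad dp] := socleP Dd.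
  by apply: (transvection_fix p_pr cAA sCA kap_char Ad dp); rewrite kapC // nz1.
- apply/subsetP=> _ /imsetP[m Wm ->].
  have /eqP m0 : m i0 == 0%R by rewrite inE in Wm.
  apply: (transvection_fix p_pr cAA sCA (chi_comb_char m) Ay yp).
  by rewrite chi_comb_y m0 nz1.
by apply: (transvection_fix p_pr cAA sCA kap_char Ay yp);
  rewrite kap_y two_neq0.
Qed.

Lemma fix_eq phi x : phi \in 'C_(Aut A)(C | 'P) -> x \in C -> phi x = x.
Proof. by case/setIP=> _ /astabP/(_ x)/[apply]. Qed.

Lemma Ohm_decomp x : x \in A -> x ^+ p = 1 -> exists2 d,
  d \in socle & x = y ^+ kap x * d.
Proof.
move=> Ax xp; have /mulsgP[c _ Cc /cycleP[k ->] def_x] := Ohm_sub Ax xp.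
have Ac := subsetP sCA c Cc.
have kx : y ^+ kap x = y ^+ k.
  by rewrite def_x kapM ?groupX // kapC // add0r (charX _ kap_char) // kap_y
    expg_natFp.
exists c; last by rewrite kx def_x; apply: (centsP cAA); rewrite ?groupX.
rewrite inE Cc /=; move: xp; rewrite def_x expgMn; last by apply: (centsP cAA);
  rewrite ?groupX.
by rewrite -expgM mulnC expgM yp expg1n mulg1 => ->.
Qed.

(** Since phi fixes C, and with it all p-th powers, it moves y and each a i by elements of order
    dividing p, which lie in C[p] + <y>. Its coefficient u on y must be 1 because phi has p-power
    order. What remains of phi factors into an element of V, an element of W and commutators. *)
Lemma p_elt_heis phi : phi \in 'C_(Aut A)(C | 'P) -> p.-elt phi -> phi \in heis.
Proof.
move=> Gphi p_phi; have /setIP[Aphi _] := Gphi.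
have phiM x z : x \in A -> z \in A -> phi (x * z) = phi x * phi z.
  by move=> Ax Az; rewrite -(autmE Aphi) morphM.
have phiX x k : x \in A -> phi (x ^+ k) = phi x ^+ k.
  by move=> Ax; rewrite -(autmE Aphi) morphX.
have Aphix x : x \in A -> phi x \in A by apply: Aut_closed.
have [d Dd phiy] : exists2 d, d \in socle & phi y = y ^+ kap (phi y) * d.
  by apply: Ohm_decomp; rewrite ?Aphix // -phiX // yp (fix_eq Gphi).
set u := kap (phi y) in phiy.
have Cy k d' : d' \in C -> kap (y ^+ (k : 'F_p) * d') = k.
  move=> Cd'; have Ad' := subsetP sCA d' Cd'.
  by rewrite kapM ?groupX // kapF // kap_y (kapC Cd') mulr1 addr0.
have phik k : exists2 d', d' \in C & (phi ^+ k) y = y ^+ (u ^+ k)%R * d'.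
  elim: k => [|k [d' Cd' IHk]].
    by exists 1; rewrite // perm1 expr0 (@expg_natFp p _ y p_pr yp 1) mulg1.
  have [Cd Ad dp] := socleP Dd; have Ad' := subsetP sCA d' Cd'.
  exists (d ^+ (u ^+ k)%R * d'); first by rewrite groupM ?groupX.
  rewrite expgSr permM IHk phiM ?groupX // phiX // (fix_eq Gphi Cd') phiy.
  rewrite expgMn; last by apply: (centsP cAA); rewrite ?groupX.
  by rewrite -expgFpM // -exprS mulgA.
(* Some p^e-th power of phi is trivial, so u^(p^e) = 1, while raising to the p-th power is the
   identity on F_p. *)
have u1 : u = 1%R.
  have [e def_e] := p_natP p_phi.
  have [d' Cd' ] := phik (p ^ e)%N; rewrite -def_e expg_order perm1 => def_y.
  have := congr1 kap def_y; rewrite Cy // kap_y => ->.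
  rewrite def_e; elim: (e) => [|k IHk]; first by rewrite expn0 expr1.
  by rewrite expnSr exprM -IHk -[X in (_ ^+ X)%R](card_Fp p_pr) expf_card.
rewrite u1 (@expg_natFp p _ y p_pr yp 1) expg1 in phiy.
have /fin_all_exists[z zP] i : exists z, z \in socle /\
    phi (a i) = a i * y ^+ kap ((a i)^-1 * phi (a i)) * z.
  have [||z Dz zE] := @Ohm_decomp ((a i)^-1 * phi (a i)).
  - by rewrite groupM ?groupV ?Aphix.
  - rewrite expgMn; last by apply: (centsP cAA); rewrite ?groupV ?Aphix.
    by rewrite -phiX // (fix_eq Gphi) ?ApC // expgVn mulVg.
  by exists z; rewrite -mulgA -zE mulKVg.
pose m : {ffun 'I_n -> 'F_p} :=
  [ffun i => if i == i0 then 0%R else kap ((a i)^-1 * phi (a i))].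
have my : chi_comb m y = 0%R by rewrite chi_comb_y ffunE eqxx.
have Dz i : z i \in socle by have [] := zP i.
have [Azz zzE] := prod_T (index_enum basis_idx) (fun i =>
  unit_coef (val i)) (fun i => Dz (val i)).
have [Av vE] := T_socleP kap_char Dd; have [Aw wE] := T_yP (chi_comb_char m) my.
have Vv : T d kap \in upper by apply/imsetP; exists d.
have Ww : T y (chi_comb m) \in lower by apply/imsetP; exists m;
  rewrite // inE ffunE eqxx.
have sVH : upper \subset heis by rewrite /= -joingA joing_subl.
have sWH : lower \subset heis by rewrite /= (joingC upper_set) -joingA
  joing_subl.
(* The first factor accounts for y, the second for the components along y of the changes of the
   other a j, and the last for their components z j in C[p]. *)
have -> : phi = T d kap * T y (chi_comb m) * \prod_(i : basis_idx) T (z (val i))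
  (chi_comb (unit_coef (val i))).
  apply: (eq_Aut_basis Aphi (groupM (groupM Av Aw) Azz)) => [x Cx | j].
    have Ax := subsetP sCA x Cx; have [_ l0] := chi_comb_char m.
    rewrite (fix_eq Gphi Cx) !permM vE // kapC // mulg1 wE // (l0 x) // mulg1
      zzE //.
    by rewrite big1 ?mulg1 // => i _; have [_ ->] :=
      chi_comb_char (unit_coef (val i)).
  have [Cd Ad dp] := socleP Dd; have [lM l0] := chi_comb_char m.
  rewrite !permM vE // wE ?groupM ?groupX // zzE ?groupM ?groupX //.
  have -> : chi_comb m (a j * d ^+ kap (a j)) = m j.
    by rewrite lM ?groupX // (charF _ (chi_comb_char m)) // (l0 d) // mulr0
      addr0 chi_comb_a.
  under eq_bigr => i _.
    have [eM e0] := chi_comb_char (unit_coef (val i)).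
    rewrite !eM ?groupM ?groupX // !(charF _ (chi_comb_char _)) // (e0 d) //
      mulr0 addr0.
    rewrite chi_comb_a chi_comb_y !ffunE [i0 == _]eq_sym (negPf (valP i)) mulr0
      addr0.
    over.
  rewrite /kap chia /m ffunE; have [-> | nj] := eqVneq j i0.
    rewrite a0 phiy expg0 mulg1 (@expg_natFp p _ d p_pr dp 1) expg1.
    by rewrite big1 ?mulg1 // => i _; rewrite [i0 == _]eq_sym (negPf (valP i)).
  rewrite expg0 mulg1.
  have [_ phia] := zP j; rewrite {1}phia; congr (_ * _).
  rewrite (eq_bigr (fun i => if i == Sub j nj then z (val i) else 1)) => [|i _].
    by rewrite -big_mkcond big_pred1_eq.
  have [-> | ni] := eqVneq i (Sub j nj).
    have [_ _ dz] := socleP (Dz j).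
    by rewrite SubK eqxx (@expg_natFp p _ _ p_pr dz 1) expg1.
  by have [ij | //] := eqVneq j (val i); case/eqP: ni; apply: val_inj;
    rewrite SubK.
apply: groupM; first by rewrite groupM ?(subsetP sVH _ Vv) ?(subsetP sWH _ Ww).
apply: group_prod => i _.
have Dz' : (z (val i))^-1 \in socle by apply: socleV.
have ei0 : unit_coef (val i) i0 = 0%R by rewrite ffunE [i0 == _]eq_sym (negPf
  (valP i)).
(* Each remaining factor is a commutator of V and W, by the formula for [comm_TdTy] read
   backwards. *)
rewrite -[z _]invgK -comm_TdTy //; apply: groupR.
  by apply: (subsetP sVH); apply/imsetP; exists (z (val i))^-1.
exact: (subsetP sWH _ (lower_gen_in i)).
Qed.

(** A Sylow p-subgroup consists of p-elements and so lies in [heis], whose index is therefore prime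
    to p. *)
Lemma centralizer_pgood_basis : pgood p 'C_(Aut A)(C | 'P).
Proof.
apply: (p'_index_pgood heis_sub _ heis_pgood).
have [P sylP] := Sylow_exists p ('C_(Aut A)(C | 'P)).
have /and3P[sPG pP p'GP] := sylP.
have sPH : P \subset heis.
  by apply/subsetP=> phi Pphi; apply: p_elt_heis;
    [apply: (subsetP sPG) | apply: mem_p_elt Pphi].
by apply: pnat_dvd p'GP; apply: indexgS.
Qed.
End CentralizerAut.

Section CentralizerPGood.
Local Open Scope group_scope.

Theorem centralizer_pgood (p : nat) (gT : finGroupType) (A C : {group gT}) (y :
  gT) :
    prime p -> p <> 2 -> p <> 3 -> abelian A -> C \subset A ->
    (forall x, x \in A -> x ^+ p \in C) ->
    y \in A -> y ^+ p = 1 -> y \notin C ->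
    (forall x, x \in A -> x ^+ p = 1 -> x \in C * <[y]>) ->
  pgood p 'C_(Aut A)(C | 'P).
Proof.
move=> p_pr p2 p3 cAA sCA ApC Ay yp notCy Ohm_sub.
have [n [i0 [a [chi [[a0 Aa chiM chiC chia] chi_inj]]]]] :=
  dual_basis p_pr cAA sCA ApC Ay notCy.
exact: (centralizer_pgood_basis p_pr p2 p3 cAA sCA ApC Ay yp Ohm_sub a0 Aa
  chiM chiC chia chi_inj).
Qed.

End CentralizerPGood.

(** * Extending automorphisms *)

Section ExtendAut.
Local Open Scope group_scope.
Variables (p : nat) (gT : finGroupType).
Hypothesis p_pr : prime p.

Lemma aut_of_morph (A : {group gT}) (f : gT -> gT) :
    {in A &, {morph f : x z / x * z}} -> (forall x, x \in A -> f x \in A) ->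
    (forall x, x \in A -> f x = 1 -> x = 1) ->
  exists2 phi, phi \in Aut A & {in A, phi =1 f}.
Proof.
move=> fM fA f1; have injf : 'injm (Morphism fM).
  by apply/subsetP=> x /morphpreP[Ax /set1P fx1]; apply/set1P/f1.
have im_f : Morphism fM @* A = A.
  apply/eqP; rewrite eqEcard card_injm // leqnn andbT.
  by apply/subsetP=> _ /morphimP[x _ Ax ->]; apply: fA.
by exists (aut injf im_f); [apply: Aut_aut | move=> x Ax; rewrite autE].
Qed.

Lemma restr_pgood (D : {group gT}) (P : {group {perm gT}}) :
    P \subset 'N(D | 'P) -> pgood p (P :&: 'C(D | 'P)) ->
  pgood p (restr_perm D @* P) -> pgood p P.
Proof.
move=> nDP pK pI; apply: (@morphim_pgood p _ _ _ [morphism of restrm nDP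
  (restr_perm D)]).
  by rewrite ker_restrm ker_restr_perm.
by rewrite morphim_restrm setIid.
Qed.

(** A / F is elementary abelian, so D / F has a complement K / F. Extend psi by the identity on K;
    the two maps agree on the intersection of D and K because it lies in F. *)
Lemma extend_fixing_Aut (A F D : {group gT}) psi :
    abelian A -> D \subset A -> F \subset D ->
    (forall x, x \in A -> x ^+ p \in F) -> psi \in 'C_(Aut D)(F | 'P) ->
  exists2 phi, phi \in Aut A & {in D, phi =1 psi}.
Proof.
move=> cAA sDA sFD ApF /setIP[Dpsi /astabP Fpsi].
have nFA : A \subset 'N(F) by rewrite sub_abelian_norm // (subset_trans sFD).
have nsFA : F <| A by rewrite /normal (subset_trans sFD).
have abE : p.-abelem (A / F).
  rewrite abelemE // quotient_abelian //; apply/exponentP=>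
    _ /morphimP[x Nx Ax ->].
  by rewrite -morphX //; apply: coset_id; apply: ApF.
have /splitsP[Kq /complP[tiK defK]] := abelem_splits abE (quotientS F sDA).
have sKq : Kq \subset A / F by rewrite -defK mulG_subr.
have [K defKq sFK sKA] := inv_quotientS nsFA sKq.
have tiDK : D :&: K \subset F.
  rewrite -quotient_sub1 ?(subset_trans (subsetIl _ _)) ?(subset_trans sDA) //.
  by rewrite -tiK defKq quotientI.
have mulDK : D * K = A.
  apply/eqP; rewrite eqEsubset mul_subG //=.
  have : A / F \subset (D * K) / F.
    by rewrite quotientMl ?(subset_trans sDA) // -defKq defK.
  rewrite sub_quotient_pre // quotientK ?mul_subG ?(subset_trans sDA)
    ?(subset_trans sKA) //.
  by rewrite mulgA (mulSGid sFD).
have cDK : K \subset 'C(D) by rewrite (subset_trans sKA) // (subset_trans cAA)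
  ?centS.
have defA : D \* K = A by rewrite cprodE.
pose f1 := autm Dpsi; pose f2 := idm K.
have c12 : f2 @* K \subset 'C(f1 @* D) by rewrite morphim_idm // im_autm.
have e12 : {in D :&: K, f1 =1 f2}.
  by move=> x DKx; rewrite /f2 /idm /f1 autmE; apply: Fpsi;
    apply: (subsetP tiDK).
pose h := cprodm defA c12 e12.
have imh : h @* A = A by rewrite im_cprodm im_autm morphim_idm.
have injh : 'injm h by rewrite -card_im_injm imh.
exists (aut injh imh); first exact: Aut_aut.
by move=> x Dx; rewrite autE ?(subsetP sDA) // [LHS]cprodmEl //= autmE.
Qed.

(** Adjoin to D one element x at a time, sending x to a p-th root of h (x^p). The condition on p-th
    powers persists, because these already lie in the original D. Injectivity is not claimed. *)
Lemma extend_morph (A : {group gT}) : abelian A ->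
  forall (D : {group gT}) (h : gT -> gT), D \subset A ->
    {in D &, {morph h : x z / x * z}} -> (forall x, x \in D -> h x \in A) ->
    (forall x, x \in A -> x ^+ p \in D /\ exists2 u,
      u \in A & u ^+ p = h (x ^+ p)) ->
  exists h' : gT -> gT, [/\ {in A &, {morph h' : x z / x * z}},
    (forall x, x \in A -> h' x \in A) & {in D, h' =1 h}].
Proof.
move=> cAA D; have [m] := ubnP (#|A| - #|D|); elim: m D =>
  // m IHm D /ltnSE-lem.
move=> h sDA hM hA rootp.
have [sAD | /subsetPn[x Ax notDx]] := boolP (A \subset D).
  have eqDA : D = A by apply/val_inj/eqP; rewrite /= eqEsubset sDA.
  by exists h; rewrite -eqDA; split=> // x; rewrite {2}eqDA; apply: hA.
have [Dxp [u Au up]] := rootp x Ax.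
pose f := Morphism hM.
have nDA : A \subset 'N(D) by rewrite sub_abelian_norm.
have nDx := subsetP nDA x Ax.
(* The image of x in A / D has order exactly p, so <x> meets D in the powers of x^p, where the two
   maps agree. *)
have dvd_k k : x ^+ k \in D -> p %| k.
  move=> Dxk; have <- : #[coset D x] = p.
    apply: nt_prime_order => //; first by rewrite -morphX //; apply: coset_id.
    by apply: contra notDx => /eqP/coset_idr->.
  by rewrite order_dvdn -morphX //; apply/eqP; apply: coset_id.
have upX k : u ^+ (k * p) = f (x ^+ (k * p)).
  by rewrite mulnC !expgM up -[h _]/(f _) -morphX.
have dvd_ux : #[u] %| #[x].
  have /dvdnP[k ox] : p %| #[x] by apply: dvd_k; rewrite expg_order group1.
  by rewrite order_dvdn [X in u ^+ X]ox upX -ox expg_order morph1.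
have sxA : <[x]> \subset A by rewrite cycle_subG.
have cDx : <[x]> \subset 'C(D) by rewrite (subset_trans sxA) // (subset_trans
  cAA) ?centS.
have defD' : D \* <[x]> = D <*> <[x]> by rewrite cprodEY.
pose g := eltm_morphism dvd_ux.
have imf : f @* D \subset A by apply/subsetP=> _ /morphimP[z _ Dz ->];
  apply: hA.
have img : g @* <[x]> \subset A.
  by rewrite /= morphim_cycle ?cycle_id // /= eltm_id cycle_subG.
have cfg : g @* <[x]> \subset 'C(f @* D).
  by rewrite (subset_trans img) // (subset_trans cAA) ?centS.
have efg : {in D :&: <[x]>, f =1 g}.
  move=> z /setIP[Dz /cycleP[k def_z]]; rewrite def_z in Dz *.
  by have /dvdnP[l ->] := dvd_k k Dz; rewrite /g /= eltmE upX.
pose h1 := cprodm_morphism defD' cfg efg.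
have sDD' : D \subset D <*> <[x]> by apply: joing_subl.
have h1D : {in D, h1 =1 h} by move=> z Dz; rewrite /h1 /= cprodmEl.
have lt_m : #|A| - #|D <*> <[x]>| < m.
  apply: leq_trans lem; apply: ltn_sub2l; apply: proper_card; apply/properP.
    by split=> //; exists x.
  by split=> //; exists x => //; rewrite mem_gen // inE cycle_id orbT.
have [|||z Az|h' [h'M h'A h'E]] := IHm (D <*> <[x]>)%G lt_m h1.
- by rewrite join_subG sDA.
- by move=> y z D'y D'z; apply: (morphM h1).
- move=> z D'z; have: h1 z \in h1 @* (D <*> <[x]>) by apply: mem_morphim.
  rewrite im_cprodm; apply: subsetP; exact: mul_subG.
- have [Dzp [v Av vp]] := rootp z Az; split; first exact: (subsetP sDD').
  by exists v; rewrite // h1D.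
by exists h'; split=> // z Dz; rewrite h'E ?h1D ?(subsetP sDD').
Qed.

(* psi is first extended by the identity on a complement of F in F 'Ohm_1(A), *)
(* so that every further extension is injective on 'Ohm_1(A), hence on A.     *)
Lemma extend_Aut_powers (A F : {group gT}) psi :
    p.-group A -> abelian A -> F = [set x ^+ p | x in A] :> {set gT} ->
    psi \in Aut F ->
  exists2 phi, phi \in Aut A & {in F, phi =1 psi}.
Proof.
move=> pA cAA defF Fpsi.
have sFA : F \subset A by rewrite defF; apply/subsetP=> _ /imsetP[x Ax ->];
  apply: groupX.
have ApF x : x \in A -> x ^+ p \in F by move=> Ax; rewrite defF; apply: imset_f.
pose Om := 'Ohm_1(A)%G; have sOA : Om \subset A by apply: Ohm_sub.
have abOm : p.-abelem Om by apply: Ohm1_abelem.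
have /splitsP[B /complP[tiB defOm]] := abelem_splits abOm (subsetIr F Om).
have sBO : B \subset Om by rewrite -defOm mulG_subr.
have sBA : B \subset A := subset_trans sBO sOA.
have tiFB : F :&: B = 1.
  apply/trivgP; rewrite -tiB subsetI subsetIr andbT subsetI subsetIl.
  by rewrite (subset_trans (subsetIr _ _)).
have cFB : B \subset 'C(F) by rewrite (subset_trans sBA) // (subset_trans cAA)
  ?centS.
have defD : F \* B = F <*> B by rewrite cprodEY.
pose f1 := autm Fpsi; pose f2 := idm B.
have c12 : f2 @* B \subset 'C(f1 @* F) by rewrite morphim_idm // im_autm.
have e12 : {in F :&: B, f1 =1 f2}.
  by move=> x; rewrite tiFB => /set1P->; exact: (morph1 (autm_morphism Fpsi)).
pose h := cprodm_morphism defD c12 e12.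
have sFD : F \subset F <*> B by apply: joing_subl.
have hF x : x \in F -> h x = psi x by move=> Fx;
  rewrite /h /= cprodmEl //= autmE.
have hB x : x \in B -> h x = x by move=> Bx; rewrite /h /= cprodmEr.
have sDA : F <*> B \subset A by rewrite join_subG sFA.
have hD x : x \in F <*> B -> h x \in A.
  move=> Dx; have: h x \in h @* (F <*> B) by apply: mem_morphim.
  by rewrite im_cprodm im_autm morphim_idm //; apply: subsetP; apply: mul_subG.
have rootp x : x \in A ->
    x ^+ p \in F <*> B /\ exists2 u, u \in A & u ^+ p = h (x ^+ p).
  move=> Ax; split; first by rewrite (subsetP sFD) ?ApF.
  rewrite hF ?ApF //; have : psi (x ^+ p) \in F by rewrite Aut_closed ?ApF.
  by rewrite [in X in X -> _]defF => /imsetP[u Au ->]; exists u.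
have [h' [h'M h'A h'E]] := @extend_morph A cAA (F <*> B)%G h sDA (morphM h) hD
  rootp.
have h'F x : x \in F -> h' x = psi x by move=> Fx;
  rewrite h'E ?hF ?(subsetP sFD).
have [|phi Aphi phiE] := aut_of_morph h'M h'A; last first.
  by exists phi => // x Fx; rewrite phiE ?(subsetP sFA) ?h'F.
(* A nontrivial kernel would contain an element x = y b of order p with y in F and b in B. Its image
   is (psi y) b, so b lies in both F and B and is 1, whence y = 1. *)
suff/eqP kh'1 : 'ker (Morphism h'M) == 1.
  by move=> x Ax h'x1; apply/set1gP; rewrite -kh'1; apply/kerP.
rewrite -(Ohm1_eq1 ('ker (Morphism h'M))) -subG1; apply/subsetP=> x Kx.
have skA : 'ker (Morphism h'M) \subset A by apply: subsetIl.
have : x \in Om by apply: subsetP Kx; apply: OhmS.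
have {}Kx : x \in 'ker (Morphism h'M) by apply: subsetP Kx; apply: Ohm_sub.
rewrite -{1}defOm => /mulsgP[y b /setIP[Fy Oy] Bb def_x].
have h'x1 : h' x = 1 by apply: (mker Kx).
have Ay := subsetP sFA y Fy; have Ab := subsetP sBA b Bb.
have def_b : b = (psi y)^-1.
  apply/eqP; rewrite eq_sym eq_invg_mul -(h'F y) // -[X in _ * X](hB b) //.
  rewrite -(h'E b) ?mem_gen ?inE ?Bb ?orbT // -h'M //.
  by rewrite -def_x h'x1.
have b1 : b = 1.
  apply/set1gP; rewrite -tiFB inE Bb andbT def_b groupV.
  exact: Aut_closed.
have y1 : y = 1.
  apply: (@perm_inj _ psi); have -> : psi 1 = 1
    by apply: (morph1 (autm_morphism Fpsi)).
  by rewrite -[LHS]invgK -def_b b1 invg1.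
by rewrite def_x b1 y1 mulg1 set11.
Qed.

(** * Centralizers of the p-th powers, and the whole automorphism group *)

Hypotheses (p2 : p <> 2) (p3 : p <> 3).

(** Induction on the index of F. A Sylow p-subgroup S of the centralizer N stabilizes F1 = F <y> for
    a suitable y of order p outside F, so the stabilizer P of F1 in N has index prime to p.
    Restriction of P to F1 has as kernel the centralizer of F1, covered by induction, and as image
    all automorphisms of F1 fixing F, covered by [centralizer_pgood]. *)
Theorem centralizer_powers_pgood (A F : {group gT}) :
    p.-group A -> abelian A -> F \subset A -> (forall x,
      x \in A -> x ^+ p \in F) ->
    (exists y, [/\ y \in A, y ^+ p = 1 & y \notin F]) ->
  pgood p 'C_(Aut A)(F | 'P).
Proof.
move=> pA cAA; have [m] := ubnP (#|A| - #|F|).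
elim: m F => // m IHm F /ltnSE-lem sFA ApF [x0 [Ax0 x0p notFx0]].
set N := 'C_(Aut A)(F | 'P).
have [S sylS] := Sylow_exists p N; have /and3P[sSN pS p'NS] := sylS.
pose Om := 'Ohm_1(A)%G; have sOA : Om \subset A by apply: Ohm_sub.
have OmP x : reflect (x \in A /\ x ^+ p = 1) (x \in Om).
  have -> : Om = 'Ldiv_(p ^ 1)(A) :> {set gT} by apply: OhmEabelian => //;
    apply: abelianS cAA.
  exact: LdivP.
have cFO : Om \subset 'C(F) by rewrite (subset_trans sOA) // (subset_trans cAA)
  ?centS.
pose D := (F <*> Om)%G; have sDA : D \subset A by rewrite join_subG sFA.
have defD : D = F * Om :> {set gT} by rewrite /= cent_joinEr.
have SA s : s \in S -> s \in Aut A by move=> Ss; have /setIP[] :=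
  subsetP sSN s Ss.
have SF s x : s \in S -> x \in F -> s x = x.
  by move=> Ss Fx; have /setIP[_ /astabP] := subsetP sSN s Ss; apply.
have Scoset s x : s \in S -> x \in A -> ('P^*)%act (F :* x) s = F :* s x.
  move=> Ss Ax; transitivity (s @: (F :* x)); first by [].
  apply/setP=> z; apply/imsetP/rcosetP.
    case=> _ /rcosetP[f Ff ->] ->; exists f => //=.
    by rewrite -(autmE (SA s Ss)) morphM ?(subsetP sFA _ Ff) //= !autmE (SF s
      f).
  case=> f Ff ->; exists (f * x); first by apply/rcosetP; exists f.
  by rewrite /= -(autmE (SA s Ss)) morphM ?(subsetP sFA _ Ff) //= !autmE (SF s
    f).
have actsS : [acts S, on rcosets F D | 'P^*].
  apply/subsetP=> s Ss; rewrite 3!inE andTb; apply/subsetP=>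
    _ /rcosetsP[x Dx ->].
  rewrite inE Scoset ?(subsetP sDA) //; apply/rcosetsP; exists (s x) => //.
  move: Dx; rewrite defD => /mulsgP[f u Ff /OmP[Au up] ->].
  rewrite -(autmE (SA s Ss)) morphM ?(subsetP sFA _ Ff) //= !autmE (SF s f) //
    mem_mulg //.
  apply/OmP; split; first by rewrite Aut_closed ?SA.
  by rewrite -(autmE (SA s Ss)) -morphX //= up morph1.
have pD : p.-group D by apply: pgroupS pA.
have sFD : F \subset D by apply: joing_subl.
have sOD : Om \subset D by apply: joing_subr.
have p_idx : p %| #|D : F|.
  have [[|e] idxE] := p_natP (pnat_dvd (dvdn_indexg D F) pD); last
    by rewrite idxE expnS dvdn_mulr.
  case/negP: notFx0; move/eqP: idxE; rewrite expn0 indexg_eq1 => /subsetP;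
    apply.
  by rewrite (subsetP sOD) //; apply/OmP.
(* S acts on the cosets of F in D, whose number is divisible by p. The coset F is fixed, so the
   p-group S fixes another one, and it is represented by an element of order p. *)
have [y [Oy notFy fixy]] : exists y, [/\ y \in Om, y \notin F &
    forall s, s \in S -> s y \in F :* y].
  have := pgroup_fix_mod pS actsS; rewrite (eqP (_ : #|rcosets F D| %% p == 0))
    //.
  set X := 'Fix_(_ | _)(S) => /esym/eqP X0.
  have XF : F :* 1 \in X.
    apply/setIP; split; first by apply/rcosetsP; exists 1.
    apply/afixP=> s Ss.
    by rewrite Scoset // SF.
  have : X != [set F :* 1].
    apply: contraL X0 => /eqP->; rewrite cards1 modn_small ?prime_gt1 //.
  rewrite eqEsubset sub1set XF andbT => /subsetPn[Z /setIP[/rcosetsP[x Dx ->]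
    /afixP fixZ]].
  move: Dx; rewrite defD => /mulsgP[f y Ff Oy def_x]; rewrite inE => nFx.
  have Fx : F :* x = F :* y by rewrite def_x rcosetM rcoset_id.
  exists y; split=> [//||s Ss].
    by apply: contra nFx => Fy; rewrite Fx mulg1 rcoset_id.
  by rewrite -Fx -(fixZ s Ss) Fx Scoset ?rcoset_refl // (subsetP sOA).
have [Ay yp] := OmP y Oy.
have cFy : <[y]> \subset 'C(F) by rewrite (subset_trans _ cFO) // cycle_subG.
pose F1 := (F <*> <[y]>)%G.
have defF1 : F1 = F * <[y]> :> {set gT} by rewrite /= cent_joinEr.
have sFF1 : F \subset F1 by apply: joing_subl.
have F1y : y \in F1 by rewrite mem_gen // inE cycle_id orbT.
have sF1A : F1 \subset A by rewrite join_subG sFA cycle_subG.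
(* If F1 already contains A[p], the centralizer of F itself is covered by the case of a single y.
   Otherwise x1 keeps the induction hypothesis applicable to F1. *)
have [sOF1 | /subsetPn[x1 Ox1 notF1x1]] := boolP (Om \subset F1).
  apply: (centralizer_pgood p_pr p2 p3 cAA sFA ApF Ay yp notFy) => x Ax xp.
  by rewrite -defF1 (subsetP sOF1) //; apply/OmP.
have [Ax1 x1p] := OmP x1 Ox1.
pose P := (N :&: 'N(F1 | 'P))%G.
have nF1 s : s \in Aut A -> (forall x, x \in F -> s x = x) -> s y \in F :* y ->
    s \in 'N(F1 | 'P).
  move=> As sF /rcosetP[f Ff sy]; rewrite 3!inE andTb; apply/subsetP=> x.
  rewrite inE /= defF1 => /mulsgP[g _ Fg /cycleP[k ->] ->]; rewrite -defF1;
    change (s (g * y ^+ k) \in F1).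
  rewrite -(autmE As) morphM ?groupX ?(subsetP sFA _ Fg) // morphX //= !autmE
    (sF g) // sy.
  have [F1g F1f] := (subsetP sFF1 g Fg, subsetP sFF1 f Ff).
  by rewrite groupM ?groupX ?groupM.
have sSP : S \subset P.
  apply/subsetP=> s Ss; rewrite inE (subsetP sSN) // nF1 ?SA ?fixy // => x;
    exact: SF.
have sPN : P \subset N by apply: subsetIl.
apply: (p'_index_pgood sPN (pnat_dvd (indexgS N sSP) p'NS)).
have nF1P : P \subset 'N(F1 | 'P) by apply: subsetIr.
have cF1N : 'C_(Aut A)(F1 | 'P) = P :&: 'C(F1 | 'P).
  apply/setP=> s; apply/setIP/setIP=> [[As /astabP F1s]|[/setIP[/setIP[As _]
    _]]] //.
  have sF x : x \in F -> s x = x by move=> Fx; apply: F1s;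
    apply: (subsetP sFF1).
  split; last exact/astabP.
  apply/setIP; split; first by apply/setIP; split=> //; apply/astabP.
  by apply: nF1 => //; rewrite [s y]F1s // rcoset_refl.
apply: (restr_pgood nF1P).
  rewrite -cF1N; apply: IHm => //; last first.
  - by exists x1.
  - by move=> x Ax; rewrite (subsetP sFF1) ?ApF.
  apply: leq_trans lem; apply: ltn_sub2l; apply: proper_card; apply/properP.
    by split=> //; exists x0.
  by split=> //; exists y.
have -> : restr_perm F1 @* P = 'C_(Aut F1)(F | 'P).
  apply/setP=> phi; apply/morphimP/setIP=> [[s nF1s Ps ->] | [F1phi /astabP
    phiF]].
    have /setIP[/setIP[As /astabP sF] _] := Ps; split;
      first exact: Aut_restr_perm As.
    by apply/astabP=> x Fx; rewrite /= apermE restr_permE ?(subsetP sFF1) //;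
      apply: sF.
  have Cphi : phi \in 'C_(Aut F1)(F | 'P) by apply/setIP; split=> //;
    apply/astabP.
  have [s As sE] := extend_fixing_Aut cAA sF1A sFF1 ApF Cphi.
  have Ps : s \in P.
    have sF x : x \in F -> s x = x.
      by move=> Fx; rewrite sE ?(subsetP sFF1) //; apply: phiF.
    have nF1s : s \in 'N(F1 | 'P).
      rewrite 3!inE andTb; apply/subsetP=> x F1x; rewrite inE.
      by change (s x \in F1); rewrite sE // Aut_closed.
    by apply/setIP; split=> //; apply/setIP; split=> //; apply/astabP.
  exists s; rewrite ?(subsetP nF1P) //; apply: (eq_Aut F1phi).
    exact: Aut_restr_perm As.
  by move=> x F1x; rewrite restr_permE ?sE // (subsetP nF1P).
(* Inside F1 = F <y> the condition on elements of order p is automatic. *)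
apply: (centralizer_pgood p_pr p2 p3 _ sFF1 _ F1y yp notFy) => [|x F1x|x F1x _].
- exact: abelianS cAA.
- by apply: ApF; apply: (subsetP sF1A).
by rewrite -defF1.
Qed.

(** Descending induction on j along the subgroups p^j A. Restriction maps Aut (p^j A) onto Aut
    (p^(j+1) A) by [extend_Aut_powers]. The hypothesis provides the element of order p that the
    kernel needs; for a sum of cyclic groups it says that no part size below the largest is
    skipped. *)
Theorem Aut_pgood (A : {group gT}) :
    p.-group A -> abelian A ->
    (forall j, 'Mho^j(A) != 1 ->
       exists y, [/\ y \in 'Mho^j(A), y ^+ p = 1 & y \notin 'Mho^j.+1(A)]) ->
  pgood p (Aut A).
Proof.
move=> pA cAA layer.
suff pgM k j : k + j = #|A| -> pgood p (Aut 'Mho^j(A)).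
  by have := pgM #|A| 0 (addn0 _); rewrite Mho0.
elim: k j => [j|k IHk j].
  (* The order of A serves as a crude bound: if it is p^e, then e < p^e, so the p^#|A|-th power of
     every element is 1. *)
  rewrite add0n => ->; have -> : 'Mho^(#|A|)(A) = 1.
    have [e defA] := p_natP pA.
    apply/eqP; rewrite -subG1 /= (MhoEabelian _ pA cAA).
    apply/subsetP=> _ /imsetP[x Ax ->]; rewrite inE -order_dvdn.
    apply: dvdn_trans (order_dvdG Ax) _; rewrite {1}defA dvdn_exp2l //.
    by rewrite defA ltnW // ltn_expl ?prime_gt1.
  by rewrite Aut1; apply: trivg_pgood.
rewrite addSnnS => kj; have pgS := IHk j.+1 kj.
have [M1 | /layer ntM] := eqVneq 'Mho^j(A) 1.
  by rewrite M1 Aut1; apply: trivg_pgood.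
set M := 'Mho^j(A) in ntM *; set F := 'Mho^j.+1(A) in pgS ntM.
have sMA : M \subset A by apply: Mho_sub.
have [pM cMM] := (pgroupS sMA pA, abelianS sMA cAA).
have defF : F = [set x ^+ p | x in M].
  rewrite /F /M !(MhoEabelian _ pA cAA); apply/setP=> x; apply/imsetP/imsetP.
    case=> z Az ->; exists (z ^+ (p ^ j)); first exact: imset_f.
    by rewrite -expgM -expnSr.
  by case=> _ /imsetP[z Az ->] ->; exists z; rewrite // -expgM -expnSr.
have sFM : F \subset M by rewrite defF; apply/subsetP=> _ /imsetP[x Mx ->];
  apply: groupX.
have MpF x : x \in M -> x ^+ p \in F by move=> Mx; rewrite defF; apply: imset_f.
have Aut_pow phi x : phi \in Aut M -> x \in M -> phi (x ^+ p) = phi x ^+ p.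
  by move=> Mphi Mx; rewrite -(autmE Mphi) morphX.
have nFM : Aut M \subset 'N(F | 'P).
  apply/subsetP=> phi Mphi; rewrite 3!inE andTb; apply/subsetP=> x Fx;
    rewrite inE.
  change (phi x \in F); move: Fx; rewrite {1}defF => /imsetP[z Mz ->].
  by rewrite Aut_pow // MpF // Aut_closed.
apply: (restr_pgood nFM).
  exact: (centralizer_powers_pgood pM cMM sFM MpF ntM).
have -> : restr_perm F @* Aut M = Aut F; last by [].
apply/eqP; rewrite eqEsubset restr_perm_Aut //=; apply/subsetP=> psi Fpsi.
have [phi Mphi phiE] := extend_Aut_powers pM cMM defF Fpsi.
apply/morphimP; exists phi; rewrite ?(subsetP nFM) //.
apply: (eq_Aut Fpsi); first exact: Aut_restr_perm Mphi.
by move=> x Fx; rewrite restr_permE ?phiE // (subsetP nFM).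
Qed.

End ExtendAut.

(** * Two-cocycles *)

(** The adjective refers to the trivial action: this is the 2-cocycle identity, with the negative
    terms moved across. *)
Definition trivial_cocycle (gT : finGroupType) (M : finZmodType)
    (phi : gT -> gT -> M) :=
  (forall g h k, phi h k + phi g (h * k)%g = phi (g * h)%g k + phi g h)%R.

Section CocycleExtension.
Local Open Scope group_scope.
Local Open Scope ring_scope.
Variables (gT : finGroupType) (M : finZmodType) (phi : gT -> gT -> M).
Hypothesis phiP : trivial_cocycle phi.

(** The type carries the cocycle condition as an argument so that the group structure, which depends
    on it, can be attached canonically. *)
Definition cocycle_ext of trivial_cocycle phi : Type := (M * gT)%type.
Local Notation E := (cocycle_ext phiP).

HB.instance Definition _ := Finite.copy E (M * gT)%type.

Definition cext_mul (x y : E) : E :=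
  (x.1 + y.1 + phi x.2 y.2, (x.2 * y.2)%g).
(* The cocycle is not normalized, hence this unit.                            *)
Definition cext_one : E := (- phi 1%g 1%g, 1%g).
Definition cext_inv (x : E) : E :=
  (- x.1 - phi (x.2^-1)%g x.2 - phi 1%g 1%g, (x.2^-1)%g).

Lemma cocycle1l k : phi 1%g k = phi 1%g 1%g.
Proof. by have := phiP 1%g 1%g k; rewrite !mul1g => /addrI. Qed.

Lemma cocycle1r g : phi g 1%g = phi 1%g 1%g.
Proof. by have := phiP g 1%g 1%g; rewrite !mulg1 => /addIr/esym. Qed.

Fact cext_mulA : associative cext_mul.
Proof.
move=> [m1 g] [m2 h] [m3 k]; congr pair => /=; last exact: mulgA.
rewrite -!addrA; congr (_ + _); congr (_ + _).
by rewrite phiP [RHS]addrCA [phi g h + _]addrC.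
Qed.

Fact cext_mul1 : left_id cext_one cext_mul.
Proof.
by move=> [m g]; congr pair => /=; rewrite ?mul1g // cocycle1l addrAC addNr
  add0r.
Qed.

Fact cext_mulV : left_inverse cext_one cext_inv cext_mul.
Proof.
move=> [m g]; congr pair => /=; rewrite ?mulVg //.
by rewrite addrAC -[X in X + _ = _]addrA [_ + phi _ _]addrC addrA subrK addrAC
  addNr add0r.
Qed.

HB.instance Definition _ :=
  Finite_isGroup.Build E cext_mulA cext_mul1 cext_mulV.

Definition cext_proj (x : E) : gT := x.2.

Fact cext_projM : {in [set: E] &, {morph cext_proj : x y / (x * y)%g}}.
Proof. by []. Qed.
Definition cext_proj_morphism := Morphism cext_projM.

Lemma cext_proj_onto : (cext_proj_morphism @* [set: E])%g = [set: gT].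
Proof.
apply/setP=> g; rewrite inE; apply/morphimP.
by exists ((0, g) : E); rewrite ?inE.
Qed.

Lemma ker_cext_proj (x : E) : x \in 'ker cext_proj_morphism -> x = (x.1,
  1%g) :> M * gT.
Proof. by case: x => m g /mker /= ->. Qed.

Lemma ker_cext_proj_central : 'ker cext_proj_morphism \subset 'Z([set: E]).
Proof.
apply/subsetP=> x /ker_cext_proj def_x; rewrite inE inE; apply/centP=> y _.
case: x def_x => m g /= [->]; case: y => n h; congr pair => /=.
  by rewrite cocycle1l cocycle1r [n + m]addrC.
by rewrite mul1g mulg1.
Qed.

Lemma ker_cext_proj_pgroup (p : nat) : p.-nat #|M| ->
  p.-group ('ker cext_proj_morphism).
Proof.
move=> pM; apply: pnat_dvd pM; suff -> : #|'ker cext_proj_morphism| = #|M|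
  by [].
have injf : injective (fun m : M => (m, 1%g) : E) by move=> m m' [].
rewrite -(card_imset M injf) /=; apply: eq_card => x; apply/idP/imsetP =>
  [Kx|[m _ ->]].
  by exists x.1; rewrite ?inE // {1}(ker_cext_proj Kx).
by apply/kerP; rewrite ?inE.
Qed.

(** A complement K of the kernel contains exactly one pair (c g, g) over each g. Closure of K under
    products reads c (g h) = c g + c h + phi g h, so phi is the coboundary of - c. *)
Lemma cocycle_split (p : nat) : p.-nat #|M| -> central_ext_split p [set: gT] ->
  exists c : gT -> M, forall g h, phi g h = c h - c (g * h)%g + c g.
Proof.
move=> pM splG.
have /splitsP[K /complP[tiK defK]] := splG _ [set: E]%G _ cext_proj_onto
  ker_cext_proj_central (ker_cext_proj_pgroup pM).
have K_onto g : exists m : M, ((m, g) : E) \in K.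
  have : ((0, g) : E) \in ('ker cext_proj_morphism * K)%g by rewrite defK inE.
  case/mulsgP=> x [m h] Kx Km def_g; exists m.
  move: (congr1 cext_proj def_g); rewrite [RHS]cext_projM ?inE //.
  by rewrite [cext_proj x](mker Kx) mul1g /= => ->.
have K_inj g m m' : ((m, g) : E) \in K -> ((m', g) : E) \in K -> m = m'.
  move=> Km Km'; set x := ((m, g) : E) in Km; set y := ((m', g) : E) in Km'.
  suff: (x^-1 * y)%g = 1%g by move/eqP; rewrite -eq_mulVg1 => /eqP[].
  apply/set1gP; rewrite -tiK; apply/setIP; split; last
    by rewrite groupM ?groupV.
  apply/kerP; rewrite ?inE //.
  by rewrite morphM ?inE ?morphV ?inE //= mulVg.
have /fin_all_exists[c cP] := K_onto.
exists (fun g => - c g) => g h.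
have Kgh : ((c g + c h + phi g h, (g * h)%g) : E) \in K
  by apply: (groupM (cP g) (cP h)).
rewrite -(K_inj _ _ _ Kgh (cP _)) opprK.
rewrite [RHS]addrC !addrA [- c g - c h + c g]addrAC addNr add0r.
by rewrite addNr add0r.
Qed.

End CocycleExtension.

Section TrivialCohomology.
Local Open Scope group_scope.
Local Open Scope ring_scope.
Variables (gT : finGroupType) (M : finZmodType).
Let MG := trivial_gmodule gT M.

Lemma differential1E (b : cochain MG 1) (g h : gT) :
  differential b [tuple g; h] = b [tuple h] - b [tuple (g * h)%g] + b [tuple g].
Proof.
rewrite ffunE big_ord1 /= expr1 expr2 mulrNN mulr1 !mulrNz !mulr1z.
have -> : face_first [tuple g; h] = [tuple h].
  by apply: eq_from_tnth => i; rewrite tnth_mktuple ord1.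
have -> : face_last [tuple g; h] = [tuple g].
  by apply: eq_from_tnth => i; rewrite tnth_mktuple ord1.
have -> // : face_mul [tuple g; h] ord0 = [tuple (g * h)%g].
by apply: eq_from_tnth => i; rewrite tnth_mktuple ord1.
Qed.

Lemma differential2E (f : cochain MG 2) (g h k : gT) :
  differential f [tuple g; h; k] = f [tuple h; k] - f [tuple (g * h)%g; k]
    + f [tuple g; (h * k)%g] - f [tuple g; h].
Proof.
rewrite ffunE big_ord_recr big_ord1 /=.
have -> : face_first [tuple g; h; k] = [tuple h; k].
  by apply: eq_from_tnth => i; rewrite tnth_mktuple; case: i => [[|[|[]]]].
have -> : face_last [tuple g; h; k] = [tuple g; h].
  by apply: eq_from_tnth => i; rewrite tnth_mktuple; case: i => [[|[|[]]]].
have -> : face_mul [tuple g; h; k] (widen_ord (leqnSn 1) ord0) = [tuple (g *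
  h)%g; k].
  by apply: eq_from_tnth => i; rewrite tnth_mktuple; case: i => [[|[|[]]]].
have -> : face_mul [tuple g; h; k] ord_max = [tuple g; (h * k)%g].
  by apply: eq_from_tnth => i; rewrite tnth_mktuple; case: i => [[|[|[]]]].
have -> : (-1) ^+ 1 = -1 :> int by [].
have -> : (-1) ^+ 2 = 1 :> int by [].
have -> : (-1) ^+ 3 = -1 :> int by [].
by rewrite mulrN1z mulrN1z mulr1z !addrA.
Qed.

Lemma trivial_cohomology2_eq1 (p : nat) :
  p.-nat #|M| -> central_ext_split p [set: gT] -> cohomology MG 2 = 1%g.
Proof.
move=> pM splG.
have abM : abelian [set: cochain MG 2] by apply: FinRing.zmod_abelian.
have nBZ : cocycles MG 2 \subset 'N(coboundaries MG 2).
  exact: subset_trans (subsetT _) (sub_abelian_norm abM (subsetT _)).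
apply/trivgP; rewrite /cohomology (quotient_sub1 nBZ).
apply/subsetP=> f /mker df0.
pose phi g h := f [tuple g; h].
have phiP : trivial_cocycle phi.
  move=> g h k; have : differential f [tuple g; h; k] = 0
    by rewrite [differential f]df0 ffunE.
  rewrite differential2E => /eqP; rewrite subr_eq0 => /eqP.
  by rewrite /phi => <-; rewrite [RHS]addrA [X in _ = X + _]addrCA subrr addr0.
have [c phiE] := cocycle_split phiP pM splG.
apply/morphimP; pose b : cochain MG 1 := [ffun t => c (thead t)].
exists b; rewrite ?inE //; apply/ffunP=> t.
have [g [h ->]] : exists g h, t = [tuple g; h].
  by exists (thead t), (tnth t ord_max); apply: eq_from_tnth => i; case: i =>
    [[|[|[]]]] //= *; congr tnth; apply: val_inj.
by rewrite differential1E !ffunE -[LHS]/(phi g h) phiE.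
Qed.

End TrivialCohomology.

(** * The group of a staircase partition *)

Section StaircasePartition.
Local Open Scope group_scope.
Local Open Scope ring_scope.
Variables (p : nat) (la : mpartition).
Hypothesis p_pr : prime p.
Hypothesis hla : forall i : 'I_(nparts la), part la i = (nparts la - i)%N.

Let A := abgrp p la.

Lemma pX_gt1 l : (0 < l)%N -> (1 < p ^ l)%N.
Proof. by move=> l_gt0; rewrite -(exp1n l) ltn_exp2r ?prime_gt1. Qed.

Lemma abgrpMn (x : A) n i : (x *+ n) i = x i *+ n.
Proof. by elim: n => [|n IHn]; rewrite ?mulr0n ?mulrS ffunE ?IHn. Qed.

Lemma Zp_exp_eq0 l n (z : 'Z_(p ^ l)) : (0 < l <= n)%N -> z *+ (p ^ n) = 0.
Proof.
case/andP=> l_gt0 le_ln; rewrite -mulr_natr -(subnK le_ln) expnD natrM.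
by rewrite pchar_Zp ?mulr0 // pX_gt1.
Qed.

Lemma abgrp_exp (x : A) n : (nparts la <= n)%N -> x *+ (p ^ n) = 0.
Proof.
move=> le_n; apply/ffunP=> i; rewrite abgrpMn [RHS]ffunE.
by rewrite Zp_exp_eq0 // Defs.part_gt0 hla (leq_trans (leq_subr _ _)).
Qed.

Lemma abgrp_pgroup : p.-group [set: A].
Proof.
rewrite -pnat_exponent; apply: (@pnat_dvd _ (p ^ nparts la)%N).
  by apply/exponentP=> x _; rewrite FinRing.zmodXgE abgrp_exp.
by rewrite pnatX pnat_id.
Qed.

Lemma MhoA j : ('Mho^j([set: A]) = [set x *+ (p ^ j) | x in [set: A]])%g.
Proof.
exact: (MhoEabelian _ abgrp_pgroup (FinRing.zmod_abelian _)).
Qed.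

(** Since j + 1 is a part, take p^j e with e a generator of a summand Z/p^(j+1). It has order p, and
    it is not in p^(j+1) A because that subgroup has zero component in this summand. *)
Lemma abgrp_layer j : ('Mho^j([set: A]) != 1 ->
  exists y, [/\ y \in 'Mho^j([set: A]), y ^+ p = 1 & y \notin 'Mho^j.+1([set:
    A])])%g.
Proof.
move=> ntM; have ltj : (j < nparts la)%N.
  rewrite ltnNge; apply: contra ntM => le_j; rewrite -subG1 /= MhoA.
  by apply/subsetP=> _ /imsetP[x _ ->]; rewrite abgrp_exp // inE.
(* With zero-based indices the part at i is [nparts la] - i, so the part j + 1 sits at [nparts la] -
   (j + 1). *)
have lti : (nparts la - j.+1 < nparts la)%N by rewrite ltn_subrL (leq_trans _
  ltj).
pose i := Ordinal lti.
have parti : part la i = j.+1 by rewrite hla /= subKn.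
pose idx : {i : 'I_(nparts la) & 'I_(multiplicity la i)} :=
  Tagged _ (Ordinal (multiplicity_gt0 i)).
pose e : A := [ffun x => (x == idx)%:R].
exists (e *+ (p ^ j)); split.
- by rewrite MhoA; apply: imset_f.
- rewrite FinRing.zmodXgE -mulrnA -expnSr; apply/ffunP=> x;
  rewrite abgrpMn [RHS]ffunE ffunE.
  have [-> | _] := eqVneq x idx; last by rewrite mul0rn.
  by rewrite Zp_exp_eq0 // Defs.part_gt0 /= parti leqnn.
rewrite MhoA; apply/imsetP=> -[z _ /(congr1 (fun f : A => f idx))].
have zi0 : z idx *+ (p ^ j.+1) = 0 by rewrite Zp_exp_eq0 // Defs.part_gt0 /=
  parti leqnn.
rewrite !abgrpMn ffunE eqxx zi0 => /(congr1 val) /=.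
rewrite val_Zp_nat ?pX_gt1 ?Defs.part_gt0 //= parti modn_small.
  by move/eqP; rewrite expn_eq0 (gtn_eqF (prime_gt0 p_pr)).
by rewrite ltn_exp2l ?prime_gt1.
Qed.

Hypotheses (p2 : p <> 2) (p3 : p <> 3).

(** The injection [sgval] transports the property from the subgroup Aut A to the group type built on
    it. *)
Lemma autgrp_pgood : pgood p [set: autgrp p la].
Proof.
apply: (@morphim_pgood p _ _ [set: autgrp p la]%G [morphism of (@sgval _ (Aut
  [set: A]))]).
  by rewrite ker_sgval; apply: trivg_pgood.
rewrite im_sgval; apply: Aut_pgood => //; first exact: abgrp_pgroup.
  exact: FinRing.zmod_abelian.
exact: abgrp_layer.
Qed.
End StaircasePartition.

Theorem theorem6p39
  (la : mpartition)
  (hla : forall i : 'I_(nparts la), part la i = (nparts la - i)%N)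
  (p : nat) (hp : prime p) (hodd : odd p) (hp3 : p <> 3%N) :
  cohomology (trivial_gmodule (autgrp p la) 'Z_p) 2 = 1%g
  /\ cohomology (trivial_gmodule (autgrp p la) (abgrp p la)) 2 = 1%g.
Proof.
have p2 : p <> 2 by move=> p2; rewrite p2 in hodd.
have [_ splG] := autgrp_pgood hp hla p2 hp3.
(* The splitting property covers all p-groups as central kernels, so only the orders of Z/p and of A
   need checking. *)
split; apply: (trivial_cohomology2_eq1 (p := p)) => //.
  by rewrite card_ord Zp_cast ?prime_gt1 ?pnat_id.
by rewrite -cardsT; apply: abgrp_pgroup.
Qed.
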